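(* Let $X$ be a normal projective $\mathbb Q$-factorial surface with finitely generated divisor class group and Picard rank $3$. If there exists a tuple $\mathcal S=(D_1,\dots,D_n)$ of classes of irreducible curves on $X$ such that $\dim(\mathrm{Cone}(\mathcal S))=3$ and the intersection form is negative semi-definite on $\mathrm{Cone}(D_n,D_1)$ and on $\mathrm{Cone}(D_i,D_{i+1})$ for $1\le i\le n-1$, then $\mathrm{Eff}(X)=\mathrm{Cone}(\mathcal S)$.
   Context: Write $\mathrm{Cl}_{\mathbb R}(X)=\mathrm{Cl}(X)\otimes\mathbb R$, where $\mathrm{Cl}(X)$ is the divisor class group. $\mathrm{Cone}(\mathcal S)$ denotes the cone in $\mathrm{Cl}_{\mathbb R}(X)$ generated by the classes in $\mathcal S$ (and similarly for any tuple of classes), and $\mathrm{Eff}(X)\subseteq\mathrm{Cl}_{\mathbb R}(X)$ is the cone generated by the classes of effective divisors. The intersection form being negative semi-definite on $\mathrm{Cone}(D,D')$ means that the $2\times2$ intersection matrix of $(D,D')$ is negative semi-definite.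
   Formalization: The curves whose classes are D_1,…,D_n are assumed pairwise distinct; with repeated entries the claim fails, e.g. S=(E_1,E_3,E_5,E_3) on a toric surface of Picard rank 3 with five negative boundary curves. *)

(* Defs.v *)
From HB Require Import structures.
From mathcomp Require Import all_boot all_order all_algebra.
From mathcomp Require Import boolp reals.
From mathcomp.multinomials Require Import mpoly freeg.

Set Implicit Arguments.
Unset Strict Implicit.
Unset Printing Implicit Defensive.

Import Order.TTheory GRing.Theory Num.Theory.
Local Open Scope ring_scope.
Local Open Scope quotient_scope.

(** * Projective varieties

    An integral closed subvariety of P^N over an algebraically closed field k
    is given by its homogeneous prime ideal in k[x_0, ..., x_N]; the ideal must
    not contain all the coordinates (which would define the empty set).
    Closed points are the subvarieties of dimension 0. *)

Record projvar (k : closedFieldType) (N : nat) := ProjVar {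
  hideal :> {pred {mpoly k[N.+1]}};
  hideal_ideal : idealr_closed hideal;
  hideal_prime : prime_idealr_closed hideal;
  hideal_homog : forall F d, F \in hideal -> pihomog mdeg d F \in hideal;
  hideal_relevant : exists i : 'I_N.+1, 'X_i \notin hideal
}.

HB.instance Definition _ (k : closedFieldType) (N : nat) :=
  gen_eqMixin (projvar k N).
HB.instance Definition _ (k : closedFieldType) (N : nat) :=
  gen_choiceMixin (projvar k N).

(** Inclusion of varieties is reverse inclusion of ideals. *)
Definition subvariety (k : closedFieldType) (N : nat) (Y X : projvar k N) :=
  {subset X <= Y}.

(** Krull dimension, by chains of irreducible closed subsets. *)
Fixpoint dim_ge (k : closedFieldType) (N : nat) (X : projvar k N) (d : nat) :
    Prop :=
  if d is d'.+1
  then exists Y : projvar k N, [/\ subvariety Y X, Y != X & dim_ge Y d']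
  else True.

Definition has_dim (k : closedFieldType) (N : nat) (X : projvar k N) (d : nat) :=
  dim_ge X d /\ ~ dim_ge X d.+1.

Definition point (k : closedFieldType) (N : nat) (X : projvar k N) :=
  {P : projvar k N | `[< subvariety P X /\ has_dim P 0 >]}.

(** Irreducible curves on X; on a surface these are the prime divisors. *)
Definition curve (k : closedFieldType) (N : nat) (X : projvar k N) :=
  {C : projvar k N | `[< subvariety C X /\ has_dim C 1 >]}.

(** * Homogeneous coordinate ring, function field and local rings *)

HB.instance Definition _ (k : closedFieldType) (N : nat) (X : projvar k N) :=
  isIdealr.Build {mpoly k[N.+1]} (hideal X) (@hideal_ideal k N X).
HB.instance Definition _ (k : closedFieldType) (N : nat) (X : projvar k N) :=
  isPrimeIdealrClosed.Build {mpoly k[N.+1]} (hideal X) (@hideal_prime k N X).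

Definition coord_ring (k : closedFieldType) (N : nat) (X : projvar k N) :=
  {ideal_quot (hideal X)}.

HB.instance Definition _ (k : closedFieldType) (N : nat) (X : projvar k N) :=
  GRing.ComNzRing.on (coord_ring X).

Section CoordRingIsDomain.
Variables (k : closedFieldType) (N : nat) (X : projvar k N).
Local Notation A := (coord_ring X).

Definition coord_unit : pred A := fun x => `[< exists y, y * x = 1 >].

Definition coord_inv (x : A) : A :=
  if pselect (exists y, y * x = 1) is left ex then projT1 (cid ex) else x.

Fact coord_mulVr : {in coord_unit, left_inverse 1 coord_inv *%R}.
Proof.
move=> x /asboolP ex; rewrite /coord_inv.
by case: pselect => // ex'; case: (cid ex').
Qed.

Fact coord_unitPl (x y : A) : y * x = 1 -> coord_unit x.
Proof. by move=> xy; apply/asboolP; exists y. Qed.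

Fact coord_invr_out : {in [predC coord_unit], coord_inv =1 id}.
Proof.
move=> x /negP ux; rewrite /coord_inv; case: pselect => // ex.
by case: ux; apply/asboolP.
Qed.

End CoordRingIsDomain.

HB.instance Definition _ (k : closedFieldType) (N : nat) (X : projvar k N) :=
  GRing.ComNzRing_hasMulInverse.Build (coord_ring X)
    (@coord_mulVr k N X) (@coord_unitPl k N X) (@coord_invr_out k N X).

Fact coord_domain (k : closedFieldType) (N : nat) (X : projvar k N) :
  GRing.integral_domain_axiom (coord_ring X).
Proof. by move=> x y; exact: Quotient.rquot_IdomainAxiom. Qed.

HB.instance Definition _ (k : closedFieldType) (N : nat) (X : projvar k N) :=
  GRing.ComUnitRing_isIntegral.Build (coord_ring X) (@coord_domain k N X).

(** The function field k(X) is the subfield of [coord_frac X] consisting of the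
    quotients of forms of equal degree, see [funfield] below. *)
Definition coord_frac (k : closedFieldType) (N : nat) (X : projvar k N) :=
  {fraction (coord_ring X)}.

HB.instance Definition _ (k : closedFieldType) (N : nat) (X : projvar k N) :=
  GRing.Field.on (coord_frac X).

Definition coord (k : closedFieldType) (N : nat) (X : projvar k N)
  (F : {mpoly k[N.+1]}) : coord_frac X :=
  tofrac (\pi_(coord_ring X) F : coord_ring X).

(** [local_ideal X Z Y] is the ideal of (the trace of) Y in O_{X,Z}, as a
    set of rational functions on X, for Z and Y closed subvarieties of X. *)
Definition local_ideal (k : closedFieldType) (N : nat) (X Z Y : projvar k N)
    (f : coord_frac X) : Prop :=
  exists d : nat, exists F G : {mpoly k[N.+1]},
    [/\ F \is d.-homog, G \is d.-homog, F \in hideal Y, G \notin hideal Z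
      & f = coord X F / coord X G].
Arguments local_ideal {k N} X Z Y f.

(** The local ring O_{X,Z} of X along a subvariety Z. *)
Definition local_ring (k : closedFieldType) (N : nat) (X Z : projvar k N)
    (f : coord_frac X) : Prop :=
  exists d : nat, exists F G : {mpoly k[N.+1]},
    [/\ F \is d.-homog, G \is d.-homog, G \notin hideal Z
      & f = coord X F / coord X G].
Arguments local_ring {k N} X Z f.

Definition local_unit (k : closedFieldType) (N : nat) (X Z : projvar k N)
    (f : coord_frac X) : Prop :=
  exists2 g, local_ring X Z g & local_ring X Z f /\ f * g = 1.
Arguments local_unit {k N} X Z f.

(** k(X) is the local ring of X at its generic point. *)
Definition funfield (k : closedFieldType) (N : nat) (X : projvar k N) :=
  local_ring X X.
Arguments funfield {k N} X f.

Definition normal_variety (k : closedFieldType) (N : nat) (X : projvar k N) :=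
  forall (P : point X) (f : coord_frac X) (p : {poly coord_frac X}),
    funfield X f -> p \is monic ->
    (forall i, local_ring X (val P) p`_i) -> root p f ->
    local_ring X (val P) f.

(** * Divisors, class group and Picard group *)

Definition divisor (k : closedFieldType) (N : nat) (X : projvar k N) :=
  {freeg (curve X) / int}.

HB.instance Definition _ (k : closedFieldType) (N : nat) (X : projvar k N) :=
  GRing.Zmodule.on (divisor X).

Definition mult (k : closedFieldType) (N : nat) (X : projvar k N)
  (C : curve X) (D : divisor X) : int := coeff C D.

Definition prime_div (k : closedFieldType) (N : nat) (X : projvar k N)
  (C : curve X) : divisor X := << C >>.

Definition effective (k : closedFieldType) (N : nat) (X : projvar k N)
  (D : divisor X) := forall C, 0 <= mult C D.

(** [has_order C f n]: f = u t^n with u a unit of O_{X,C} and t a generator of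
    its maximal ideal.  When X is a normal surface, O_{X,C} is a discrete
    valuation ring, so that each nonzero f in k(X) has exactly one order. *)
Definition has_order (k : closedFieldType) (N : nat) (X : projvar k N)
    (C : curve X) (f : coord_frac X) (n : int) : Prop :=
  exists t u : coord_frac X,
    [/\ (forall g, local_ideal X (val C) (val C) g <->
           exists2 h, local_ring X (val C) h & g = t * h),
        local_unit X (val C) u & f = u * t ^ n].

Definition principal (k : closedFieldType) (N : nat) (X : projvar k N)
    (D : divisor X) : Prop :=
  exists2 f, funfield X f /\ f != 0 & forall C, has_order C f (mult C D).

(** The subgroup generated by the principal divisors.  When X is a normal
    surface they already form a subgroup. *)
Definition principal_group (k : closedFieldType) (N : nat) (X : projvar k N) :
    {pred divisor X} :=
  fun D => `[< forall S : {pred divisor X}, zmod_closed S ->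
               (forall E, principal E -> E \in S) -> D \in S >].

Fact principal_group_zmod (k : closedFieldType) (N : nat) (X : projvar k N) :
  zmod_closed (@principal_group k N X).
Proof.
split=> [|D E HD HE]; apply/asboolP => S S_closed SP; have [S0 SB] := S_closed.
  exact: S0.
by apply: SB; [exact: (asboolP _ HD) | exact: (asboolP _ HE)].
Qed.

HB.instance Definition _ (k : closedFieldType) (N : nat) (X : projvar k N) :=
  GRing.isZmodClosed.Build (divisor X) (@principal_group k N X)
    (@principal_group_zmod k N X).

Definition Cl (k : closedFieldType) (N : nat) (X : projvar k N) :=
  Quotient.quot (@principal_group k N X).

HB.instance Definition _ (k : closedFieldType) (N : nat) (X : projvar k N) :=
  GRing.Zmodule.on (Cl X).

Definition divclass (k : closedFieldType) (N : nat) (X : projvar k N)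
  (D : divisor X) : Cl X := \pi_(Cl X) D.

Definition local_equation (k : closedFieldType) (N : nat) (X : projvar k N)
    (P : point X) (D : divisor X) (f : coord_frac X) : Prop :=
  [/\ funfield X f, f != 0
    & forall C : curve X, subvariety (val P) (val C) ->
        has_order C f (mult C D)].

Definition cartier (k : closedFieldType) (N : nat) (X : projvar k N)
  (D : divisor X) := forall P : point X, exists f, local_equation P D f.

Definition Qfactorial (k : closedFieldType) (N : nat) (X : projvar k N) :=
  forall D : divisor X, exists2 m : nat, (0 < m)%N & cartier (D *+ m).

(** The Picard group of a normal variety, as a subgroup of the class group. *)
Definition Pic (k : closedFieldType) (N : nat) (X : projvar k N)
  (x : Cl X) : Prop := exists2 D, cartier D & x = divclass D.

Definition finitely_generated (A : zmodType) : Prop :=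
  exists n (g : 'I_n -> A), forall x,
    exists c : 'I_n -> int, x = \sum_i g i *~ c i.

Definition Zindependent (A : zmodType) (n : nat) (x : 'I_n -> A) : Prop :=
  forall c : 'I_n -> int, \sum_i x i *~ c i = 0 -> forall i, c i = 0.

Definition has_rank (A : zmodType) (G : A -> Prop) (r : nat) : Prop :=
  (exists x : 'I_r -> A, (forall i, G (x i)) /\ Zindependent x) /\
  (forall x : 'I_r.+1 -> A, (forall i, G (x i)) -> ~ Zindependent x).

Definition picard_rank (k : closedFieldType) (N : nat) (X : projvar k N)
  (r : nat) := has_rank (@Pic k N X) r.

(** Universal property of the map x |-> x (x) 1 from A to A (x)_Z R. *)
Definition is_scalar_extension (R : realType) (A : zmodType) (V : vectType R)
    (iota : {additive A -> V}) : Prop :=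
  forall (W : lmodType R) (g : {additive A -> W}),
    exists2 h : {linear V -> W}, (forall x, h (iota x) = g x)
      & forall h' : {linear V -> W}, (forall x, h' (iota x) = g x) -> h' =1 h.

Definition curve_class (k : closedFieldType) (N : nat) (X : projvar k N)
  (R : realType) (V : vectType R) (iota : {additive Cl X -> V})
  (C : curve X) : V := iota (divclass (prime_div C)).

(** * Intersection form *)

(** The k-vector space W / J, for k-subspaces J <= W of [coord_frac X], has
    dimension d. *)
Definition quotient_dim (k : closedFieldType) (N : nat) (X : projvar k N)
    (W J : coord_frac X -> Prop) (d : nat) : Prop :=
  exists2 w : 'I_d -> coord_frac X, (forall i, W (w i))
    & forall g, W g ->
        exists! c : 'rV[k]_d, J (g - \sum_i coord X (c 0 i)%:MP * w i).

(** Local intersection number dim_k O_{X,P} / (I_C + (f)) at P of the curve C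
    with the Cartier divisor of local equation f (regular at P). *)
Definition local_intersection (k : closedFieldType) (N : nat) (X : projvar k N)
    (P : point X) (C : curve X) (f : coord_frac X) (d : nat) : Prop :=
  quotient_dim (local_ring X (val P))
    (fun g => exists a b, [/\ local_ideal X (val P) (val C) a,
                              local_ring X (val P) b & g = a + f * b]) d.

(** E is an effective Cartier divisor whose support does not contain the curve
    C, and E.C = q; the sum runs over the finitely many points P at which the
    local intersection number is not zero. *)
Definition cartier_intersection (k : closedFieldType) (N : nat)
    (X : projvar k N) (E : divisor X) (C : curve X) (q : nat) : Prop :=
  [/\ effective E, mult C E = 0 &
   exists (f : point X -> coord_frac X) (d : point X -> nat)
          (s : seq (point X)),
     [/\ forall P, local_equation P E (f P),
         forall P, local_intersection P C (f P) (d P),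
         uniq s, forall P, P \notin s -> d P = 0%N
       & q = (\sum_(P <- s) d P)%N]].

(** B is the intersection form on V = Cl(X) (x) R: it is symmetric, bilinear,
    and D.C = (mD.C)/m for distinct curves D, C and m > 0 with mD Cartier.
    On a Q-factorial surface these conditions determine B. *)
Definition is_intersection_form (k : closedFieldType) (N : nat)
    (X : projvar k N) (R : realType) (V : vectType R)
    (iota : {additive Cl X -> V}) (B : V -> V -> R) : Prop :=
  [/\ forall u v, B u v = B v u,
      forall u, scalar (B u)
    & forall (D C : curve X) (m : nat), D != C -> (0 < m)%N ->
        cartier (prime_div D *+ m) ->
        exists2 q : nat, cartier_intersection (prime_div D *+ m) C q
          & B (curve_class iota D) (curve_class iota C) = q%:R / m%:R].

Definition gram2 (R : realType) (V : vectType R) (B : V -> V -> R) (u v : V) :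
    'M[R]_2 :=
  \matrix_(i, j) B (nth 0 [:: u; v] i) (nth 0 [:: u; v] j).

Definition neg_semidefinite (R : realType) (n : nat) (M : 'M[R]_n) : Prop :=
  forall x : 'rV[R]_n, (x *m M *m x^T) 0 0 <= 0.

(** * Cones *)

Definition cone (R : realType) (V : vectType R) (A : V -> Prop) (v : V) : Prop :=
  exists n (c : 'I_n -> R) (a : 'I_n -> V),
    (forall i, 0 <= c i /\ A (a i)) /\ v = \sum_i c i *: a i.

Definition cone_of (R : realType) (V : vectType R) (s : seq V) : V -> Prop :=
  cone (fun v => v \in s).

(** The dimension of a cone is that of its linear span. *)
Definition cone_dim (R : realType) (V : vectType R) (s : seq V) : nat :=
  \dim <<s>>%VS.

Definition Eff (k : closedFieldType) (N : nat) (X : projvar k N) (R : realType)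
    (V : vectType R) (iota : {additive Cl X -> V}) : V -> Prop :=
  cone (fun v => exists2 D : divisor X, effective D & v = iota (divclass D)).

(* Main.v *)
Require Import Defs.
From HB Require Import structures.
From mathcomp Require Import all_boot all_order all_algebra.
From mathcomp Require Import boolp reals.
From mathcomp Require classical_sets.
From mathcomp.multinomials Require Import mpoly freeg.
From mathcomp Require Import lra.

(** Linear algebra.  Suppose a class C with C.D_i >= 0 for all i lies outside
    K = Cone(S).  Let H be a class with H.C > 0 and H.D_i > 0 for all i; moving
    C towards H, we may assume C.D_i > 0.  Projecting from C orders the rays D_i
    on a line; let D_m be the least one and D_a <= D_b its two cyclic neighbours,
    so that p D_m + q D_b = D_a + g C with p, q >= 0.  If g > 0, the left-hand
    side has positive square, although (D_m, D_b) is negative semi-definite; if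
    g < 0, then D_a has positive square.  So g = 0, D_a is isotropic and redundant,
    its neighbours again span a negative semi-definite pair because dim V = 3,
    and one concludes by induction on n.  The Hodge index theorem is not needed.

    Geometry.  A class H as above is obtained as a sum of curves, since through a
    point P of a curve there passes a curve outside any given finite set.  Indeed
    A = O_{X,P} is noetherian and integrally closed; choose G in its maximal ideal
    m avoiding the given curves.  If m were the only prime containing G, some z
    outside GA would satisfy z m <= GA.  Then f = z/G multiplies m into A.  If
    f m <= m, then f is integral, so f lies in A, a contradiction.  Otherwise
    m = wA is principal, and 1/w stabilizes the ideal of the curve we started
    with, so 1/w is integral, hence in A, a contradiction again. *)

Set Implicit Arguments.
Unset Strict Implicit.
Unset Printing Implicit Defensive.

Import Order.TTheory GRing.Theory Num.Theory.
Local Open Scope ring_scope.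

(** * Cones and forms on a three-dimensional space *)

Section ScalarForms.
Variables (R : realType) (V : vectType R) (l : V -> R).
Hypothesis ll : scalar l.

Lemma scalarD u v : l (u + v) = l u + l v.
Proof. by rewrite -[u]scale1r ll mul1r scale1r. Qed.

Lemma scalar0 : l 0 = 0.
Proof. by apply: (addrI (l 0)); rewrite -scalarD !addr0. Qed.

Lemma scalarZr a v : l (a *: v) = a * l v.
Proof. by rewrite -[_ *: _]addr0 ll scalar0 addr0. Qed.

Lemma scalarB u v : l (u - v) = l u - l v.
Proof. by rewrite scalarD -scaleN1r scalarZr mulN1r. Qed.

Lemma scalar_sum (I : Type) (r : seq I) (F : I -> V) :
  l (\sum_(i <- r) F i) = \sum_(i <- r) l (F i).
Proof. by elim/big_rec2: _ => [|i x y _ <-]; rewrite ?scalar0 ?scalarD. Qed.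

End ScalarForms.

Section Cones.
Variables (R : realType) (V : vectType R).
Implicit Types (A : V -> Prop) (u v : V) (s : seq V).

Lemma cone_mem A v : A v -> cone A v.
Proof.
move=> Av; exists 1%N, (fun=> 1), (fun=> v).
by rewrite big_ord1 scale1r; split=> // i; rewrite ler01.
Qed.

Lemma cone0 A : cone A 0.
Proof. by exists 0%N, (fun=> 0), (fun=> 0); rewrite big_ord0; split=> // -[]. Qed.

Lemma coneD A u v : cone A u -> cone A v -> cone A (u + v).
Proof.
move=> [n [c [a [ca ->]]]] [m [d [b [db ->]]]].
exists (n + m)%N, (fun i => match split i with inl j => c j | inr j => d j end).
exists (fun i => match split i with inl j => a j | inr j => b j end).
split=> [i|]; first by case: (split i).
rewrite big_split_ord /=; congr (_ + _); apply: eq_bigr => i _.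
  case: splitP => [j /= /ord_inj <-//|j /= /eqP].
  by rewrite eqn_leq [X in _ && X]leqNgt (leq_trans (ltn_ord i)) ?leq_addr ?andbF.
case: splitP => [j /= /eqP|j /= /addnI/ord_inj <-//].
by rewrite eqn_leq leqNgt (leq_trans (ltn_ord j)) ?leq_addr.
Qed.

Lemma coneZ A a v : 0 <= a -> cone A v -> cone A (a *: v).
Proof.
move=> a0 [n [c [b [cb ->]]]]; exists n, (fun i => a * c i), b.
split=> [i|]; last by rewrite scaler_sumr; apply: eq_bigr => i _; rewrite scalerA.
by have [c0 Ab] := cb i; rewrite mulr_ge0.
Qed.

Lemma cone_trans A A' v :
  (forall a, A a -> cone A' a) -> cone A v -> cone A' v.
Proof.
move=> AA' [n [c [b [cb ->]]]]; elim/big_ind: _ => [||i _]; [exact: cone0|exact: coneD|].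
by have [c0 Ab] := cb i; apply: coneZ => //; apply: AA'.
Qed.

Lemma nonzero_scalar v : v != 0 -> exists2 l : V -> R, scalar l & l v < 0.
Proof.
move=> v0; pose e := vbasis (@fullv _ V).
have [i ci] : exists i, coord e i v != 0.
  apply/existsP; apply/contraNT: v0 => /existsPn c0.
  rewrite (coord_vbasis (memvf v)) big1 // => i _.
  by have := c0 i; rewrite negbK => /eqP ->; rewrite scale0r.
(* The coordinate is scaled by minus its own value at [v], so that the value at [v] is minus a
   square. *)
exists (fun x => - (coord e i v * coord e i x)) => [a x y|].
  by rewrite linearP /=; lra.
by rewrite oppr_lt0 -expr2 lt_def sqrf_eq0 ci sqr_ge0.
Qed.

(** Induction on the number of generators. If the functional [l] found for the tail is negative at
    [u], each projected generator is the original one plus a nonnegative multiple of [u], and [v]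
    exceeds its projection by such a multiple; so membership lifts. A functional separating the
    projections is composed with the projection and vanishes at [u]. *)
Lemma farkas s v :
  cone_of s v \/
  exists2 l : V -> R, scalar l & (forall w, w \in s -> 0 <= l w) /\ l v < 0.
Proof.
have [k] := ubnP (size s); elim: k => // k IH in s v *.
case: s => [|u s] /=; rewrite ltnS => sk.
  have [->|/nonzero_scalar [l ll lv]] := eqVneq v 0; first by left; exact: cone0.
  by right; exists l.
have sub w : cone_of s w -> cone_of (u :: s) w.
  by apply: cone_trans => x xs; apply: cone_mem; rewrite inE xs orbT.
have [/sub|[l ll [ls lv]]] := IH s v sk; first by left.
have [lu|lu] := leP 0 (l u).
  right; exists l => //; split=> // w; rewrite inE => /orP[/eqP->//|]; exact: ls.
(* Project onto the kernel of [l] along [u] (Fourier-Motzkin). *)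
pose p x := x - (l x / l u) *: u.
have pD a x y : p (a *: x + y) = a *: p x + p y.
  rewrite /p (ll a x y) scalerBr scalerA mulrDl scalerDl -mulrA.
  by rewrite opprD addrACA.
have [] := IH [seq p w | w <- s] (p v); first by rewrite size_map.
  move=> pv; left; have -> : v = p v + (l v / l u) *: u by rewrite subrK.
  apply: coneD; last first.
    apply: coneZ; last by apply: cone_mem; rewrite mem_head.
    by rewrite ltW // nmulr_rgt0 // invr_lt0.
  apply: cone_trans pv => _ /mapP [w ws ->]; rewrite /p -scaleNr.
  apply: coneD; first by apply: cone_mem; rewrite inE ws orbT.
  apply: coneZ; last by apply: cone_mem; rewrite mem_head.
  by rewrite -mulrN mulr_ge0 ?ls // oppr_ge0 invr_le0 ltW.
move=> [l' ll' [ls' lv']]; right; exists (l' \o p) => [a x y|].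
  by rewrite /= pD ll'.
split=> // w; rewrite inE => /orP[/eqP-> /=|ws]; last by rewrite ls' // map_f.
by rewrite /p divff ?lt_eqF // scale1r subrr scalar0.
Qed.

End Cones.

Lemma pairwise_perm (T : eqType) (r : rel T) (s t : seq T) :
  ssrbool.symmetric r -> perm_eq s t -> pairwise r s -> pairwise r t.
Proof.
move=> rC; elim: s t => [|x s IH] t; first by rewrite perm_sym => /perm_nilP->.
move=> st; have xt : x \in t by rewrite -(perm_mem st) mem_head.
case/splitPr: xt st => t1 t2 st.
have {}st : perm_eq s (t1 ++ t2).
  by rewrite -(perm_cons x) (perm_trans st) // (perm_catCA t1 [:: x]).
move=> /= /andP[xs /(IH _ st)].
have : all (r x) (t1 ++ t2) by rewrite -(perm_all _ st).
rewrite all_cat !pairwise_cat /= allrel_consr => /andP[xt1 ->] /and3P[-> -> ->].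
rewrite !andbT.
by apply/allP => y /(allP xt1); rewrite rC.
Qed.

Lemma seq_argmin (T : eqType) (R : realType) (f : T -> R) (s : seq T) : s != [::] ->
  exists2 m, m \in s & forall x, x \in s -> f m <= f x.
Proof.
elim: s => [//|y s IH] _; have [->|/IH [m ms mle]] := eqVneq s [::].
  by exists y; rewrite ?mem_head // => x; rewrite inE => /eqP->.
have [ym|my] := leP (f y) (f m).
  exists y => [|x]; first exact: mem_head.
  by rewrite inE => /orP[/eqP->//|/mle]; apply: le_trans.
exists m => [|x]; first by rewrite inE ms orbT.
by rewrite inE => /orP[/eqP->|/mle//]; apply: ltW.
Qed.

Lemma small_perturbation (R : realType) (a b : R) : 0 < a ->
  exists2 e, 0 < e & forall x, 0 < x <= e -> 0 < a + x * b.
Proof.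
move=> a0; have b1 : 0 < `|b| + 1 by rewrite ltr_wpDl.
(* The summand 1 makes the bound strict: for x up to this value, a + x b is at least x. *)
exists (a / (`|b| + 1)) => [|x /andP[x0 xe]]; first by rewrite divr_gt0.
have : x * (`|b| + 1) <= a by rewrite -ler_pdivlMr.
have : x * - b <= x * `|b| by rewrite ler_pM2l // -normrN ler_norm.
lra.
Qed.

(** * Cycles of negative semi-definite pairs *)

Section NefCone.
Variables (R : realType) (V : vectType R) (B : V -> V -> R).
Hypothesis dimV : \dim (fullv : {vspace V}) = 3%N.
Hypothesis BC : forall u v, B u v = B v u.
Hypothesis Bl : forall u, scalar (B u).
Implicit Types (u v f m c : V) (s : seq V).

Lemma bformDr u v w : B u (v + w) = B u v + B u w.
Proof. exact: scalarD. Qed.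

Lemma bformZr a u v : B u (a *: v) = a * B u v.
Proof. exact: scalarZr. Qed.

Lemma bformDl u v w : B (u + v) w = B u w + B v w.
Proof. by rewrite BC bformDr !(BC w). Qed.

Lemma bformZl a u w : B (a *: u) w = a * B u w.
Proof. by rewrite BC bformZr (BC w). Qed.

(** Sign conditions on the principal minors of the Gram matrix, as a boolean relation so that
    [cycle] applies to it. *)
Definition nsd : rel V :=
  fun u v => [&& B u u <= 0, B v v <= 0 & B u v ^+ 2 <= B u u * B v v].

Lemma nsdC u v : nsd u v = nsd v u.
Proof. by rewrite /nsd (BC v u) (mulrC (B v v)) andbCA. Qed.

(** Completing the square: with a, c, b for B u u, B u v, B v v, a times the value is (a x + c y)^2
    + (a b - c^2) y^2. For a = 0 the determinant condition forces c = 0. *)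
Lemma nsd_le0 u v x y : nsd u v -> B (x *: u + y *: v) (x *: u + y *: v) <= 0.
Proof.
move=> /and3P [a0 b0 d].
rewrite bformDr !bformDl !bformZr !bformZl (BC v u).
move: (B u u) (B u v) (B v v) a0 b0 d => a c b a0 b0 d.
have [az|an] := eqVneq a 0.
  have c0 : c = 0 by apply/eqP; rewrite -sqrf_eq0 eq_le sqr_ge0 andbT (le_trans d) // az mul0r.
  by have := mulr_ge0_le0 (sqr_ge0 y) b0; rewrite az c0 expr2; lra.
have lta : a < 0 by rewrite lt_def eq_sym an.
rewrite -(@nmulr_rge0 _ a) //.
have := sqr_ge0 (a * x + c * y).
have := mulr_ge0 (sqr_ge0 y) (_ : 0 <= a * b - c ^+ 2); rewrite subr_ge0 => /(_ d).
rewrite !expr2; lra.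
Qed.

Lemma gram2_nsd u v : neg_semidefinite (gram2 B u v) -> nsd u v.
Proof.
move=> nsd_uv.
have Q x y : x * (x * B u u) + 2 * (x * (y * B u v)) + y * (y * B v v) <= 0.
  have := nsd_uv (\row_j nth 0 [:: x; y] j).
  rewrite !mxE !big_ord_recl !big_ord0 !mxE !big_ord_recl !big_ord0 !mxE /= (BC v u).
  lra.
(* Writing a, c, b for B u u, B u v, B v v, the last of these values is a (a b - c^2). *)
have := Q 1 0; have := Q 0 1; have := Q (B u v) (- B u u).
rewrite /nsd; move: (B u u) (B u v) (B v v) Q => a c b Q Q1 Q2 Q3.
have a0 : a <= 0 by lra.
have b0 : b <= 0 by lra.
rewrite a0 b0 /=.
have [az|an] := eqVneq a 0.
  have [->|cn] := eqVneq c 0; first by rewrite az expr0n mul0r.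
  (* For a = 0 the form at (x, 1) is 2 x c + b; this x gives it the value 1. *)
  have xc := divfK cn ((1 - b) / 2); have := Q ((1 - b) / 2 / c) 1.
  by rewrite az; move: (_ / c) xc => x xc; lra.
have lta : a < 0 by rewrite lt_def eq_sym an.
rewrite -subr_ge0 -(@nmulr_rle0 _ a) // expr2; lra.
Qed.

(** The orthogonal space of [f] contains [f] and misses [h], so it is a plane, and the form on it
    comes from the line that remains modulo [f]. Hence the Gram determinant of [m] and [c]
    vanishes. *)
Lemma isotropic_nsd h f m c : 0 < B h f -> B f f = 0 ->
  B f m = 0 -> B f c = 0 -> B m m <= 0 -> B c c <= 0 -> nsd m c.
Proof.
move=> hf ff fm fc mm cc; rewrite /nsd mm cc /=.
have fn0 : f != 0 by apply: contraTneq hf => ->; rewrite (scalar0 (Bl h)) ltxx.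
have [/vlineP [x mE]|mn] := boolP (m \in <[f]>%VS).
  by rewrite mE !(bformZl, bformZr) fc ff !mulr0 mul0r expr0n.
have [|cn] := boolP (c \in <<[:: m; f]>>%VS).
  rewrite span_cons span_seq1 => /memv_addP [_ /vlineP[y ->] [_ /vlineP[x ->] ->]].
  rewrite !(bformDr, bformDl, bformZr, bformZl) (BC m f) fm ff.
  rewrite !mulr0 !addr0 !expr2; lra.
(* The remaining case is absurd: a basis orthogonal to [f] contradicts B h f > 0. *)
have fr : free [:: c; m; f] by rewrite free_cons cn free_cons span_seq1 mn seq1_free fn0.
have : h \in <<[:: c; m; f]>>%VS.
  have /eqP-> : <<[:: c; m; f]>>%VS == fullv; last exact: memvf.
  by rewrite eqEdim subvf dimV (eqP fr).
rewrite !span_cons span_nil addv0.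
move=> /memv_addP [_ /vlineP[x ->] [_ /memv_addP [_ /vlineP[y ->] [_ /vlineP[z ->] ->]] hE]].
by move: hf; rewrite hE !bformDl !bformZl !(BC _ f) fm fc ff !mulr0 !addr0 ltxx.
Qed.

(** [l] and [mu] are coordinates on the plane obtained by projecting from [c]; the quotient mu / l
    orders the rays with l > 0. *)
Lemma kernel_line (l : V -> R) c d : scalar l -> c != 0 -> l c = 0 -> l d != 0 ->
  exists mu : V -> R, [/\ scalar mu, mu c = 0 &
    forall x, l x = 0 -> mu x = 0 -> exists g, x = g *: c].
Proof.
move=> ll c0 lc ld.
have fr2 : free [:: d; c].
  rewrite free_cons seq1_free c0 andbT span_seq1.
  by apply: contra ld => /vlineP [a ->]; rewrite scalarZr // lc mulr0.
have [e en] : exists e, e \notin <<[:: d; c]>>%VS.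
  apply: contrapT => no; suff : (fullv <= <<[:: d; c]>>)%VS.
    by move/dimvS; rewrite dimV (eqP fr2).
  by apply/subvP => e _; apply/negPn/negP => en; apply: no; exists e.
have fr : free [:: e; d; c] by rewrite free_cons en.
pose X := [tuple e; d; c].
have span x : x \in <<X>>%VS.
  have /eqP-> : <<X>>%VS == fullv; last exact: memvf.
  by rewrite eqEdim subvf dimV (eqP fr).
exists (coord X ord0); split => [a x y||x lx mx]; first by rewrite linearP.
  exact: (coord_free (@Ordinal 3 2 isT) ord0 fr).
have := coord_span (span x).
rewrite !big_ord_recl big_ord0 mx scale0r add0r addr0 /=.
set a := coord X _ x; set b := coord X _ x => xE.
have a0 : a = 0.
  move: lx; rewrite xE scalarD // !scalarZr // lc mulr0 addr0 => /eqP.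
  by rewrite mulf_eq0 (negPf ld) orbF => /eqP.
by exists b; rewrite {1}xE a0 scale0r add0r.
Qed.

(** Modulo [c] the slopes put [a] between [m] and [b], so [p] and [q] exist up to a multiple [g] of
    [c]; the form then excludes both signs of [g]. *)
Lemma nsd_middle (l mu : V -> R) c m a b : scalar l -> scalar mu ->
  l c = 0 -> mu c = 0 ->
  (forall x, l x = 0 -> mu x = 0 -> exists g, x = g *: c) ->
  0 < l m -> 0 < l a -> 0 < l b ->
  mu m / l m <= mu a / l a <= mu b / l b ->
  0 <= B a m -> 0 <= B a b -> nsd m b -> B a a <= 0 ->
  0 < B c m -> 0 < B c a -> 0 < B c b ->
  exists p q : R, [/\ 0 <= p, 0 <= q & a = p *: m + q *: b].
Proof.
move=> ll lmu lc muc ker lm la lb /andP[tma tab] am ab nmb aa cm ca cb.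
have [p [q [p0 q0 El Emu]]] : exists p q : R, [/\ 0 <= p, 0 <= q,
    l a = p * l m + q * l b & mu a = p * mu m + q * mu b].
  have Em : mu m = mu m / l m * l m by rewrite divfK // gt_eqF.
  have Ea : mu a = mu a / l a * l a by rewrite divfK // gt_eqF.
  have Eb : mu b = mu b / l b * l b by rewrite divfK // gt_eqF.
  move: (mu m / l m) (mu a / l a) (mu b / l b) Em Ea Eb tma tab.
  move=> tm ta tb -> -> -> tma tab.
  have [E|ne] := eqVneq tm tb.
    have -> : ta = tm by apply/eqP; rewrite eq_le tma andbT E.
    exists (l a / l m), 0; rewrite !mul0r !addr0 mulrCA divfK ?gt_eqF //.
    by split; rewrite // divr_ge0 // ltW.
  have tmb : 0 < tb - tm by rewrite subr_gt0 lt_def eq_sym ne (le_trans tma).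
  (* [w] is the weight with ta = (1 - w) tm + w tb; the factors l a / l m and l a / l b below turn
     slopes back into vectors. *)
  pose w := (ta - tm) / (tb - tm).
  have w0 : 0 <= w by rewrite divr_ge0 ?subr_ge0 // ltW // -subr_gt0.
  have w1 : 0 <= 1 - w by rewrite subr_ge0 ler_pdivrMr // mul1r lerD2r.
  have wE : w * tb - w * tm = ta - tm by rewrite -mulrBr divfK // gt_eqF.
  exists ((1 - w) * l a / l m), (w * l a / l b).
  have [[la0 lm0] lb0] := (ltW la, ltW lm, ltW lb).
  have E : (w * tb - w * tm) * l a = (ta - tm) * l a by rewrite wE.
  split; [apply: divr_ge0 => //; exact: mulr_ge0..| |].
    by rewrite !divfK ?gt_eqF //; lra.
  by rewrite [_ * (tm * _)]mulrCA [_ * (tb * _)]mulrCA !divfK ?gt_eqF //; lra.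
exists p, q; split=> //.
set P := p *: m + q *: b.
have [g Pg] : exists g, P - a = g *: c.
  by apply: ker; rewrite scalarB // scalarD // !scalarZr // -?El -?Emu subrr.
have PE : P = a + g *: c by rewrite -Pg addrC subrK.
have Pa : 0 <= B a P by rewrite bformDr !bformZr addr_ge0 // mulr_ge0.
(* [p] and [q] cannot both vanish, since l a > 0. *)
have Pc : 0 < B c P.
  rewrite bformDr !bformZr; have [pp|pn] := ltP 0 p.
    by rewrite ltr_wpDr ?mulr_gt0 // mulr_ge0 // ltW.
  have p00 : p = 0 by apply/eqP; rewrite eq_le pn.
  rewrite p00 mul0r add0r mulr_gt0 // lt_def q0 andbT.
  by apply: contraTneq la => q00; rewrite El p00 q00 !mul0r addr0 ltxx.
have PP : B P P <= 0 by exact: nsd_le0.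
have : B P P = B a P + g * B c P by rewrite {1}PE bformDl bformZl.
have : B a P = B a a + g * B a c by rewrite PE bformDr bformZr.
rewrite (BC a c) => E1 E2.
have [g0|g0|g0] := ltrgtP g 0; last by rewrite PE g0 scale0r addr0.
  all: exfalso; clear Pg PE; clearbody P.
  have ng : 0 < - g by rewrite oppr_gt0.
  have : 0 < - g * B c a by rewrite mulr_gt0.
  lra.
have : 0 < g * B c P by rewrite mulr_gt0.
lra.
Qed.

(** The square of [a] is at least 0, so [a] is isotropic and therefore orthogonal to both its
    neighbours; by [isotropic_nsd] these form an admissible pair, and [a] can be cut out of the
    cycle. *)
Lemma drop_middle (h m a b : V) (t : seq V) (p q : R) :
  0 < B h a -> cycle nsd [:: m, a & rcons t b] ->
  0 <= B a m -> 0 <= B a b -> 0 <= p -> 0 <= q -> a = p *: m + q *: b ->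
  cycle nsd (m :: rcons t b).
Proof.
move=> ha /= /andP[ma] am0 am ab p0 q0 aE.
have [mm aa mma] := and3P ma.
have aa0 : B a a = 0.
  apply/eqP; rewrite eq_le aa {2}aE bformDr // !bformZr //.
  by rewrite addr_ge0 // mulr_ge0.
have amE : B a m = 0.
  apply/eqP; rewrite -sqrf_eq0 eq_le sqr_ge0 andbT BC (le_trans mma) //.
  by rewrite aa0 mulr0.
have key c : nsd a c -> nsd m c.
  move=> /and3P[_ cc ac]; apply: (isotropic_nsd ha) => //.
  by apply/eqP; rewrite -sqrf_eq0 eq_le sqr_ge0 andbT (le_trans ac) // aa0 mul0r.
(* The successor of [a] is the head of [t], or [b] when [t] is empty. *)
by case: t am0 => [|c t] /= /andP[/key -> ->].
Qed.

(** Here [c] and [h] are the classes C and H of the overview. A functional [l] that separates [c]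
    from [s] also separates it from every shorter list with entries in [s], which contradicts the
    induction hypothesis. *)
Lemma nef_in_cone s h c :
  <<s>>%VS = fullv -> cycle nsd s ->
  pairwise (fun u v => 0 <= B u v) s ->
  (forall d, d \in s -> 0 < B h d) -> (forall d, d \in s -> 0 <= B c d) ->
  0 < B h c -> cone_of s c.
Proof.
have [k] := ubnP (size s); elim: k => // k IH in s *.
rewrite ltnS => sk sV scyc sB sh sc hc.
have [//|[l ll [ls lc]]] := farkas s c; exfalso.
(* A small multiple of [h] makes [c] strictly positive on [s] while keeping the signs of l and B h
   at it. *)
have [e [e0 lc' hc' cs]] : exists e, [/\ 0 < e, l (c + e *: h) < 0,
    0 < B h (c + e *: h) & forall d, d \in s -> 0 < B (c + e *: h) d].
  have nlc : 0 < - l c by rewrite oppr_gt0.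
  have [e1 e10 P1] := small_perturbation (- l h) nlc.
  have [e2 e20 P2] := small_perturbation (B h h) hc.
  have mp : 0 < Num.min e1 e2 by rewrite lt_min e10.
  exists (Num.min e1 e2); split => // [||d ds].
  - rewrite scalarD // scalarZr // -oppr_gt0 opprD -mulrN P1 // mp.
    by rewrite ge_min lexx.
  - by rewrite bformDr // bformZr // P2 // mp ge_min lexx orbT.
  - by rewrite bformDl // bformZl // ltr_wpDl ?sc // mulr_gt0 ?sh.
move: (c + e *: h) lc' hc' cs => c' lc' hc' cs.
(* A combination of l and B h with positive coefficients, vanishing at c' and strictly positive on
   [s]. *)
pose l' x := B h c' * l x - l c' * B h x.
have ll' : scalar l' by move=> a x y; rewrite /l' ll Bl; lra.
have lc'0 : l' c' = 0 by rewrite /l' mulrC subrr.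
have ls' d : d \in s -> 0 < l' d.
  move=> ds; rewrite /l' -mulNr ltr_wpDl ?mulr_ge0 ?ls // ?(ltW hc') //.
  by rewrite mulr_gt0 ?oppr_gt0 ?sh.
have c'0 : c' != 0 by apply: contraTneq lc' => ->; rewrite scalar0 // ltxx.
(* At least three entries: the least ray [m] has two neighbours at different positions. *)
have ss : (2 < size s)%N by rewrite -dimV -sV dim_span.
have s0 : s != [::] by case: (s) ss.
have [d0 d0s] : exists d, d \in s by case: (s) s0 => // x ? _; exists x; rewrite mem_head.
have [mu [lmu muc ker]] := kernel_line ll' c'0 lc'0 (lt0r_neq0 (ls' _ d0s)).
have [m ms mmin] := seq_argmin (fun x => mu x / l' x) s0.
(* [a] and [b] are the two cyclic neighbours of [m], with [a] the one of smaller slope. *)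
have main a b t : perm_eq s [:: m, a & rcons t b] ->
    cycle nsd [:: m, a & rcons t b] -> mu a / l' a <= mu b / l' b -> False.
  move=> st tcyc ab.
  have [as_ bs] : a \in s /\ b \in s.
    by rewrite !(perm_mem st) !in_cons !mem_rcons !in_cons !eqxx !orbT.
  have := pairwise_perm (fun u v => congr1 _ (BC u v)) st sB.
  rewrite /= all_rcons => /and3P[/andP[Bma _]].
  rewrite all_rcons => /andP[Bab _] tB.
  have mb : nsd m b.
    by move: tcyc; rewrite /= rcons_path last_rcons => /and3P[_ _]; rewrite nsdC.
  have aa : B a a <= 0 by move: tcyc => /= /andP[/and3P[]].
  have Bam : 0 <= B a m by rewrite BC.
  have [p [q [p0 q0 aE]]] : exists p q : R, [/\ 0 <= p, 0 <= q & a = p *: m + q *: b].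
    apply: (nsd_middle ll' lmu lc'0 muc ker) => //; try by [apply: ls'|apply: cs].
    by rewrite mmin.
  have := drop_middle (sh _ as_) tcyc Bam Bab p0 q0 aE => ucyc.
  have sub d : d \in m :: rcons t b -> d \in s.
    by rewrite (perm_mem st) !inE => /orP[->|->]; rewrite ?orbT.
  (* The induction hypothesis is used for the original [c], not for c', on the cycle without [a]; it
     gives l c >= 0. *)
  have : cone_of (m :: rcons t b) c.
    apply: IH => //.
    - by rewrite -ltnS -ltnS; move: sk; rewrite (perm_size st).
    - apply/eqP; rewrite eqEsubv subvf -sV; apply/span_subvP => d; rewrite (perm_mem st).
      rewrite !inE orbCA => /orP[/eqP->|]; last by move=> ?; apply: memv_span.
      rewrite aE memvD // memvZ // memv_span // ?mem_head //.
      by rewrite inE mem_rcons mem_head orbT.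
    - have := pairwise_perm (fun u v => congr1 _ (BC u v)) st sB.
      by move=> /= /andP[/andP[_ ->] /andP[_ ->]].
    - by move=> d /sub; apply: sh.
    - by move=> d /sub; apply: sc.
  move=> [n [x [y [xy cE]]]]; move: lc; rewrite cE scalar_sum // ltNge => /negP; apply.
  apply: sumr_ge0 => i _; have [x0 /sub/ls y0] := xy i.
  by rewrite scalarZr // mulr_ge0.
have [i s' rs] := rot_to ms.
have st : perm_eq s (m :: s') by rewrite -rs perm_sym perm_rot.
have tcyc : cycle nsd (m :: s') by rewrite -rs rot_cycle.
case: s' => [|a t] in st tcyc {rs}; first by move: ss; rewrite (perm_size st).
case/lastP: t => [|t b] in st tcyc *; first by move: ss; rewrite (perm_size st).
have [ab|/ltW ba] := leP (mu a / l' a) (mu b / l' b); first exact: (main a b t).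
(* If the slopes come in the other order, the cycle is reversed. *)
apply: (main b a (rev t)) => //.
  rewrite (perm_trans st) // perm_cons -(perm_rev (a :: _)) rev_cons rev_rcons.
  by [].
have E : rev [:: m, a & rcons t b] = rcons (b :: rcons (rev t) a) m.
  by rewrite !rev_cons rev_rcons.
rewrite -(rot_cycle 1) rot1_cons -E rev_cycle (eq_cycle (e' := nsd)) // => u v.
exact: nsdC.
Qed.
End NefCone.

(** * Local rings of a normal surface *)

Section Subring.
Variables (K : fieldType) (A : K -> Prop).
Hypotheses (A1 : A 1) (AB : forall x y, A x -> A y -> A (x - y)).
Hypothesis AM : forall x y, A x -> A y -> A (x * y).

Lemma subring0 : A 0.
Proof. by rewrite -(subrr 1); apply: AB. Qed.

Lemma subringN x : A x -> A (- x).
Proof. by move=> Ax; rewrite -sub0r; apply: AB => //; apply: subring0. Qed.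

Lemma subringD x y : A x -> A y -> A (x + y).
Proof. by move=> Ax Ay; rewrite -(opprK y); apply: AB => //; apply: subringN. Qed.

Lemma subring_sum I (r : seq I) (P : pred I) F :
  (forall i, P i -> A (F i)) -> A (\sum_(i <- r | P i) F i).
Proof. by apply: big_ind; [exact: subring0|exact: subringD]. Qed.

Lemma subringX x n : A x -> A (x ^+ n).
Proof. by move=> Ax; elim: n => [|n IH]; rewrite ?expr0 // exprS; apply: AM. Qed.

Lemma char_poly_subring n (M : 'M[K]_n) :
  (forall i j, A (M i j)) -> forall i, A (char_poly M)`_i.
Proof.
move=> AMij; pose PA (p : {poly K}) := forall i, A p`_i.
have PAD p q : PA p -> PA q -> PA (p + q).
  by move=> Pp Pq i; rewrite coefD; apply: subringD.
have PAN p : PA p -> PA (- p) by move=> Pp i; rewrite coefN; apply: subringN.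
have PAM p q : PA p -> PA q -> PA (p * q).
  by move=> Pp Pq i; rewrite coefM; apply: subring_sum => j _; apply: AM.
have PAC c : A c -> PA c%:P.
  by move=> Ac i; rewrite coefC; case: ifP => // _; apply: subring0.
have PA0 : PA 0 by move=> i; rewrite coef0; apply: subring0.
have PA1 : PA 1 by apply: (PAC 1).
have PAX : PA 'X.
  by move=> i; rewrite coefX; case: (i == _); [exact: A1|exact: subring0].
have h : PA (char_poly M); last exact: h.
rewrite /char_poly /determinant; apply: (big_ind PA PA0 PAD) => s _.
apply: (PAM); first by rewrite -signr_odd; case: (odd _); rewrite ?expr1 ?expr0 //; apply: PAN.
apply: (big_ind PA PA1 PAM) => i _; rewrite !mxE; apply: (PAD); last by apply/PAN/PAC.
by case: (i == _); rewrite ?mulr1n ?mulr0n.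
Qed.

(** [A] is a predicate on the field, so its ideals are predicates on the field too. *)
Definition is_ideal (I : K -> Prop) :=
  [/\ forall x, I x -> A x, I 0, forall x y, I x -> I y -> I (x + y)
    & forall a x, A a -> I x -> I (a * x)].

Definition fin_gen (I : K -> Prop) := exists n (g : 'I_n -> K),
  (forall i, I (g i)) /\
  forall x, I x -> exists c : 'I_n -> K, (forall i, A (c i)) /\ x = \sum_i c i * g i.

(** The determinant trick: [phi] acts on the generators by a matrix over [A] that has the row of
    generators as an eigenvector for [phi]; [x0] ensures that this row is nonzero. *)
Lemma stable_integral (I : K -> Prop) (phi x0 : K) : fin_gen I -> I x0 -> x0 != 0 ->
  (forall x, I x -> I (phi * x)) ->
  exists p : {poly K}, [/\ p \is monic, forall i, A p`_i & root p phi].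
Proof.
move=> [n [g [Ig gen]]] Ix0 x00 Iphi.
have /choice [c cP] : forall j, exists c : 'I_n -> K,
    (forall i, A (c i)) /\ phi * g j = \sum_i c i * g i.
  by move=> j; apply/gen/Iphi.
pose M := \matrix_(i, j) c j i; exists (char_poly M); split.
- exact: char_poly_monic.
- by apply: char_poly_subring => i j; rewrite mxE; have [] := cP j.
rewrite -eigenvalue_root_char; apply/eigenvalueP; exists (\row_j g j).
  apply/rowP => j; rewrite !mxE; have [_ ->] := cP j.
  by apply: eq_bigr => i _; rewrite !mxE mulrC.
apply: contra x00 => /eqP/rowP g0; have [d [_ ->]] := gen _ Ix0.
by rewrite big1 // => i _; have := g0 i; rewrite !mxE => ->; rewrite mulr0.
Qed.

(** The whole ring satisfies this; properness is stated separately, by an element outside the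
    ideal. *)
Definition prime_ideal (I : K -> Prop) :=
  forall x y, A x -> A y -> I (x * y) -> I x \/ I y.

Lemma ideal_addM I a : is_ideal I -> A a ->
  is_ideal (fun x => exists y b, [/\ I y, A b & x = y + b * a]).
Proof.
move=> [IA I0 ID IM] Aa; split.
- by move=> _ [y [b [/IA Ay Ab ->]]]; apply: subringD => //; apply: AM.
- by exists 0, 0; split; rewrite ?mul0r ?addr0 //; apply: subring0.
- move=> _ _ [y [b [Iy Ab ->]]] [z [c [Iz Ac ->]]]; exists (y + z), (b + c).
  by split; [exact: ID | exact: subringD | rewrite mulrDl addrACA].
move=> d _ Ad [y [b [Iy Ab ->]]]; exists (d * y), (d * b).
by split; [exact: IM | exact: AM | rewrite mulrDr mulrA].
Qed.

(** By Zorn's lemma there is an ideal maximal among those that contain [I] and no power of [g]; such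
    an ideal is prime. *)
Lemma prime_avoiding I g : is_ideal I -> A g -> (forall n, ~ I (g ^+ n)) ->
  exists Q, [/\ is_ideal Q, prime_ideal Q, forall x, I x -> Q x & ~ Q g].
Proof.
move=> Iid Ag Ig.
pose ok Q := [/\ is_ideal Q, forall x, I x -> Q x & forall n, ~ Q (g ^+ n)].
pose T := {Q | ok Q}.
pose le (P Q : T) := `[< forall x, sval P x -> sval Q x >].
have okI : ok I by [].
have [||F Ftot|[Q [Qid IQ Qg]] Qmax] := @classical_sets.ZL_preorder T (exist _ I okI) le.
- by move=> P; apply/asboolP.
- by move=> P P' P'' /asboolP h /asboolP h'; apply/asboolP => x /h/h'.
(* The empty chain is bounded by [I] itself. *)
- have [[P0 FP0]|F0] := pselect (exists P, F P); last first.
    by exists (exist _ I okI) => P FP; case: F0; exists P.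
  have chain P P' : F P -> F P' -> exists2 P'', F P'' &
      forall x, sval P x \/ sval P' x -> sval P'' x.
    move=> FP FP'; have [/asboolP h|/asboolP h] := Ftot _ _ FP FP'.
      by exists P' => // x [/h|].
    by exists P => // x [|/h].
  have okU : ok (fun x => exists2 P, F P & sval P x).
    split.
    - split.
      + by move=> x [[P [[PA _ _ _] _ _]] _ /= /PA].
      + by exists P0 => //; case: P0 {FP0} => P [[]].
      + move=> x y [P FP Px] [P' FP' Py]; have [P'' FP'' sub] := chain _ _ FP FP'.
        exists P'' => //; have := sub x (or_introl Px); have := sub y (or_intror Py).
        by case: P'' {FP'' sub} => P'' [[_ _ PD _] _ _] /= ? ?; apply: PD.
      + move=> a x Aa [P FP Px]; exists P => //; case: P Px {FP} => P [[_ _ _ PM] _ _] /=.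
        exact: PM.
    - by move=> x Ix; exists P0 => //; case: (svalP P0) => _ IP _; apply: IP.
    - by move=> n [[P [_ _ Pg]] _ /Pg].
  by exists (exist _ _ okU) => P FP; apply/asboolP => x Px; exists P.
exists Q; split => //; last by move=> Qg1; apply: (Qg 1%N); rewrite expr1.
have [QA Q0 QD QM] := Qid.
(* By maximality, adjoining an outside element brings in a power of [g]. For [x] and [y] outside
   with product in [Q], the product of two such powers would lie in [Q]. *)
have ext a : A a -> ~ Q a -> exists n y b, [/\ Q y, A b & g ^+ n = y + b * a].
  move=> Aa Qa; apply: contrapT => no.
  have okQa : ok (fun x => exists y b, [/\ Q y, A b & x = y + b * a]).
    split; first exact: ideal_addM.
    - by move=> x /IQ Qx; exists x, 0; rewrite mul0r addr0; split=> //; apply: subring0.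
    - by move=> n h; apply: no; exists n.
  have h : le (exist _ Q (And3 Qid IQ Qg)) (exist _ _ okQa).
    by apply/asboolP => x Qx /=; exists x, 0; rewrite mul0r addr0; split=> //; exact: subring0.
  have /asboolP := Qmax _ h; apply: contra_not Qa => /(_ a); apply.
  by exists 0, 1; rewrite mul1r add0r.
move=> x y Ax Ay Qxy; apply: contrapT => /not_orP[Qx Qy].
have [n [u [b [Qu Ab gn]]]] := ext _ Ax Qx; have [m [v [c [Qv Ac gm]]]] := ext _ Ay Qy.
apply: (Qg (n + m)%N); rewrite exprD gn gm mulrDl; apply: (QD).
  by rewrite mulrC; apply: QM => //; apply: subringD; [exact: QA|exact: AM].
rewrite mulrDr; apply: (QD); first by apply: QM => //; apply: AM.
by rewrite mulrACA; apply: QM => //; apply: AM.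
Qed.

(** In a noetherian integrally closed local ring of dimension at least 2, a nonzero element of the
    maximal ideal lies in a smaller prime. The nonzero prime [J], strictly smaller than [m],
    expresses the bound on the dimension. *)
Lemma normal_height_one (m J : K -> Prop) (G y0 : K) :
  is_ideal m -> ~ m 1 -> (forall a, A a -> ~ m a -> A a^-1) ->
  (forall I, is_ideal I -> fin_gen I) ->
  (forall a b p, A a -> A b -> b != 0 -> p \is monic -> (forall i, A p`_i) ->
     root p (a / b) -> A (a / b)) ->
  is_ideal J -> prime_ideal J -> J y0 -> y0 != 0 -> (exists2 z, m z & ~ J z) ->
  m G -> G != 0 ->
  exists Q, [/\ is_ideal Q, prime_ideal Q, Q G & exists2 z, m z & ~ Q z].
Proof.
move=> mid m1 loc noeth normal Jid Jp Jy0 y00 mJ mG G0.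
apply: contrapT => noQ; have [mA m0 mD mM] := mid; have [JA J0 JD JM] := Jid.
pose GA x := exists2 a, A a & x = a * G.
have GAid : is_ideal GA.
  split.
  - by move=> _ [a Aa ->]; apply: AM => //; apply: mA.
  - by exists 0; [exact: subring0|rewrite mul0r].
  - by move=> _ _ [a Aa ->] [b Ab ->]; exists (a + b); [exact: subringD|rewrite mulrDl].
  - by move=> c _ Ac [a Aa ->]; exists (c * a); [exact: AM|rewrite mulrA].
have GAG : GA G by exists 1; rewrite ?mul1r.
(* A prime containing [G] and avoiding [g] has been excluded. *)
have nil g : m g -> exists n, GA (g ^+ n).
  move=> mg; apply: contrapT => /forallNP ng.
  have [Q [Qid Qp GQ Qg]] := prime_avoiding GAid (mA _ mg) ng.
  by apply: noQ; exists Q; split=> //; [exact: GQ|exists g].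
have [n [g [mg gen]]] := noeth _ mid.
have [z [Az Gz zm]] : exists z, [/\ A z, ~ GA z & forall x, m x -> GA (z * x)].
  have [z [Az Gz zg]] : exists z, [/\ A z, ~ GA z &
      forall i, i \in enum 'I_n -> GA (z * g i)].
    (* Starting from 1, each generator of [m] contributes its largest power that keeps [z] outside
       [GA]. *)
    elim: (enum 'I_n) => [|i r [z [Az Gz zr]]].
      exists 1; split=> // -[a Aa aG]; apply: m1; rewrite aG; exact: mM.
    have ex : exists k, GA (z * g i ^+ k).
      by have [k kG] := nil _ (mg i); exists k; case: GAid => _ _ _; apply.
    have exb : exists k, `[< GA (z * g i ^+ k) >] by have [k ?] := ex; exists k; apply/asboolP.
    case: (ex_minnP exb) => -[|k] /asboolP kG kmin; first by rewrite mulr1 in kG.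
    have Agk : A (g i ^+ k) by apply/subringX/mA/mg.
    exists (z * g i ^+ k); split; first exact: AM.
      by move=> /asboolP/kmin; rewrite ltnn.
    move=> j; rewrite inE => /orP[/eqP->|/zr jG]; first by rewrite -mulrA -exprSr.
    by rewrite mulrAC mulrC; case: GAid => _ _ _; apply.
  exists z; split=> // x /gen [c [Ac ->]]; rewrite mulr_sumr.
  apply: (big_ind GA); [by case: GAid|by case: GAid|move=> i _].
  by rewrite mulrCA; case: GAid => _ _ _; apply=> //; apply: zg; rewrite mem_enum.
have Am x : m x -> A (z / G * x).
  by move=> /zm [a Aa E]; rewrite mulrAC E mulfK.
have [stab|] := pselect (forall x, m x -> m (z / G * x)).
  have [p [pm pA pr]] := stable_integral (noeth _ mid) mG G0 stab.
  apply: Gz; exists (z / G); last by rewrite divfK.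
  by apply: normal pr => //; apply: mA.
move=> /existsNP [w /not_implyP [mw nmw]].
have w0 : w != 0 by apply: contra_notN nmw => /eqP ->; rewrite mulr0.
set u := z / G * w in nmw.
have Au : A u by apply: Am.
have u0 : u != 0 by apply: contra_notN nmw => /eqP ->.
(* [u] is a unit of [A], so [w] generates [m]. *)
have mw' x : m x -> exists2 a, A a & x = w * a.
  move=> mx; exists (z / G * x * u^-1); first by apply: AM; [exact: Am|exact: loc].
  by rewrite mulrA [w * _]mulrCA mulrA -/u mulrAC divff ?mul1r.
have Jm x : J x -> m x.
  move=> Jx; apply: contrapT => nmx; have Ax := JA _ Jx.
  have x0 : x != 0 by apply: contra_notN nmx => /eqP ->.
  have J1 : J 1 by rewrite -(mulVf x0); apply: JM => //; apply: loc.
  by have [y my] := mJ; apply; rewrite -(mulr1 y); apply: JM => //; apply: mA.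
have Jw : ~ J w.
  move=> Jw; have [y my] := mJ; apply; have [a Aa ->] := mw' _ my.
  by rewrite mulrC; apply: JM.
(* The product x = w a lies in the prime [J] and [w] does not, so [a] does. *)
have stab x : J x -> J (1 / w * x).
  move=> Jx; have [a Aa E] := mw' _ (Jm _ Jx).
  have /Jp [] // : J (w * a) by rewrite -E.
    exact: mA.
  by rewrite E mul1r mulKf.
have [p [pm pA pr]] := stable_integral (noeth _ Jid) Jy0 y00 stab.
have Aw : A (1 / w) by apply: normal pr => //; apply: mA.
by apply: m1; rewrite -(divff w0) mulrC -[w^-1]mul1r; apply: mM.
Qed.

End Subring.

(** * Dickson's lemma and Hilbert's basis theorem *)

(** Induction on [n]. A finite list [L] settles the tails. From the bound [N] on, the lifts of [L]
    suffice; each of the finitely many smaller first entries j has its own list [S j]. *)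
Lemma dickson n (P : seq nat -> Prop) : exists L : seq (seq nat),
  (forall l, l \in L -> size l = n /\ P l) /\
  forall m, size m = n -> P m -> exists2 l, l \in L & all2 leq l m.
Proof.
elim: n P => [|n IH] P.
  have [P0|P0] := pselect (P [::]); last by exists [::]; split=> // m /size0nil ->.
  exists [:: [::]]; split=> [l|m /size0nil -> _]; first by rewrite inE => /eqP ->.
  by exists [::]; rewrite ?mem_head.
have [L [LP Lmin]] := IH (fun m => exists x, P (x :: m)).
have /choice [x xP] : forall l, exists x, l \in L -> P (x :: l).
  move=> l; have [lL|] := boolP (l \in L); last by exists 0%N.
  by have [_ [x Px]] := LP l lL; exists x.
have /choice [S SP] := fun j => IH (fun m => P (j :: m)).
pose N := \max_(l <- L) x l.
exists ([seq x l :: l | l <- L] ++ flatten [seq [seq j :: l | l <- S j] | j <- iota 0 N]).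
split=> [l|[//|j m] [sm] Pm].
  rewrite mem_cat => /orP[/mapP[l' l'L ->]|].
    by have [<- _] := LP _ l'L; split=> //; apply: xP.
  by move=> /flatten_mapP[j _ /mapP[l' /(SP j).1 [<- Pl'] ->]].
have [jN|Nj] := ltnP j N.
  have [_ /(_ m sm Pm) [l lS lm]] := SP j.
  exists (j :: l); last by rewrite /= leqnn.
  rewrite mem_cat; apply/orP; right; apply/flatten_mapP; exists j; last exact: map_f.
  by rewrite mem_iota.
have [l lL lm] := Lmin m sm (ex_intro _ j Pm).
exists (x l :: l); first by rewrite mem_cat map_f.
by rewrite /= lm andbT (leq_trans _ Nj) // /N (big_rem l) //= leq_maxl.
Qed.

(** Dickson's lemma is applied to the exponents of leading monomials; division, by induction on the
    leading monomial, shows that the chosen polynomials generate. *)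
Lemma hilbert_basis (k : fieldType) n (I : {mpoly k[n]} -> Prop) :
  I 0 -> (forall F G, I F -> I G -> I (F + G)) -> (forall F G, I G -> I (F * G)) ->
  exists r (g : 'I_r -> {mpoly k[n]}), (forall i, I (g i)) /\
    forall F, I F -> exists c : 'I_r -> {mpoly k[n]}, F = \sum_i c i * g i.
Proof.
move=> I0 ID IM.
pose lead (l : seq nat) (F : {mpoly k[n]}) := [/\ I F, F != 0 & l = mlead F :> seq nat].
have [L [LP Lmin]] := dickson n (fun l => exists F, lead l F).
have /choice [f fP] : forall i : 'I_(size L), exists F, lead (nth [::] L i) F.
  by move=> i; have [_] := LP _ (mem_nth [::] (ltn_ord i)).
exists (size L), f; split=> [i|]; first by case: (fP i).
apply: mleadrect => F IH IF.
have [->|F0] := eqVneq F 0; first by exists (fun=> 0); rewrite big1 // => i _; rewrite mul0r.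
have [l /(nthP [::]) [i iL <-] lF] :=
  Lmin (mlead F) (size_tuple _) (ex_intro _ F (And3 IF F0 erefl)).
have {lF} lF : (mlead (f (Ordinal iL)) <= mlead F)%MM.
  have [_ _ E] := fP (Ordinal iL); apply/mnm_lepP => j.
  rewrite [nth _ _ _]E in lF.
  have : all2 leq (mlead (f (Ordinal iL))) (mlead F) by [].
  rewrite all2E => /andP[_ /(all_nthP (0%N, 0%N))] /(_ j).
  rewrite size_zip !size_tuple minnn nth_zip ?size_tuple //= => /(_ (ltn_ord j)).
  by rewrite -!tnth_nth.
set i' := Ordinal iL in lF; have [Ifi fi0 _] := fP i'.
(* The single term for which [c * f i'] has the leading term of [F]. *)
pose c := (mleadc F / mleadc (f i')) *: 'X_[mlead F - mlead (f i')] : {mpoly k[n]}.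
have lc0 : mleadc F / mleadc (f i') != 0 by rewrite mulf_neq0 ?invr_eq0 ?mleadc_eq0.
have mc : mlead c = (mlead F - mlead (f i'))%MM by rewrite mleadZ // mleadXm.
have cF : (c * f i')@_(mlead F) = mleadc F.
  rewrite -{1}(submK lF) -mc mleadcM mc mcoeffZ mcoeffX eqxx mulr1 divfK //.
  by rewrite mleadc_eq0.
have c0 : c != 0 by rewrite -mleadc_eq0 mc mcoeffZ mcoeffX eqxx mulr1.
have mG : mlead (c * f i') = mlead F by rewrite mleadM // mc submK.
have [d dE] : exists d : 'I_(size L) -> {mpoly k[n]}, F - c * f i' = \sum_i d i * f i.
  have [->|F'0] := eqVneq (F - c * f i') 0.
    by exists (fun=> 0); rewrite big1 // => j _; rewrite mul0r.
  apply: IH; last by apply: (ID) => //; rewrite -mulNr; apply: IM.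
  rewrite lt_neqAle; have := mleadB_le F (c * f i'); rewrite mG joinxx => ->.
  rewrite andbT; apply: contraNneq F'0 => E.
  by rewrite -mleadc_eq0 E mcoeffB cF subrr.
exists (fun j => d j + (if j == i' then c else 0)).
under eq_bigr do rewrite mulrDl.
rewrite big_split /= -dE (bigD1 i') //= eqxx big1 ?addr0 ?subrK // => j /negPf ->.
by rewrite mul0r.
Qed.

(** * Homogeneous components and homogeneous ideals *)

Section Pihomog.
Variables (k : fieldType) (n : nat).
Implicit Types F G : {mpoly k[n]}.

Lemma pihomogM d F G : pihomog mdeg d (F * G) =
  \sum_(i < d.+1) pihomog mdeg i F * pihomog mdeg (d - i) G.
Proof.
(* One bound above d and both degrees lets all decompositions run over the same indices. *)
pose b := maxn d.+1 (maxn (msize F) (msize G)).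
have Fb : F = \sum_(i < b) pihomog mdeg i F.
  by apply: pihomog_partitionE; rewrite !leq_max leqnn !orbT.
have Gb : G = \sum_(i < b) pihomog mdeg i G.
  by apply: pihomog_partitionE; rewrite !leq_max leqnn !orbT.
rewrite {1}Fb {1}Gb mulr_suml raddf_sum /=.
have db : (d.+1 <= b)%N by rewrite leq_maxl.
rewrite (big_ord_widen _ (fun i => pihomog mdeg i F * pihomog mdeg (d - i) G) db).
rewrite [RHS]big_mkcond; apply: eq_bigr => i _.
rewrite mulr_sumr raddf_sum /=.
have hom (j : nat) := dhomogM (pihomogP mdeg i F) (pihomogP mdeg j G).
rewrite ltnS; case: leqP => [id|di].
  have dib : (d - i < b)%N by rewrite (leq_trans _ db) // ltnS leq_subr.
  rewrite (bigD1 (Ordinal dib)) //= pihomog_dE; last first.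
    by have := hom (d - i)%N; rewrite subnKC.
  rewrite big1 ?addr0 // => j /eqP jd.
  apply: pihomog_ne0 (hom j); apply/eqP => ijd; apply: jd; apply: val_inj => /=.
  by rewrite -ijd addKn.
rewrite big1 // => j _; apply: pihomog_ne0 (hom j).
by rewrite gtn_eqF // ltn_addr.
Qed.

Lemma pihomog_pihomog d e F :
  pihomog mdeg e (pihomog mdeg d F) = if e == d then pihomog mdeg d F else 0.
Proof.
have [->|ed] := eqVneq; first exact: pihomog_id.
by apply: (@pihomog_ne0 _ _ _ d); rewrite 1?eq_sym // pihomogP.
Qed.

Lemma mem_homog_components (I : {pred {mpoly k[n]}}) F : 0 \in I ->
  (forall F G, F \in I -> G \in I -> F + G \in I) ->
  (forall d, pihomog mdeg d F \in I) -> F \in I.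
Proof.
move=> I0 ID Id; rewrite (@pihomog_partitionE _ _ mdeg (msize F) F) //.
by apply: (big_ind (fun F => F \in I)).
Qed.

End Pihomog.

Section Ideals.
Variables (k : closedFieldType) (N : nat).
Implicit Types (X Y Z P : projvar k N) (F G : {mpoly k[N.+1]}).

Lemma hideal0 Y : 0 \in hideal Y. Proof. exact: rpred0. Qed.
Lemma hidealD Y F G : F \in hideal Y -> G \in hideal Y -> F + G \in hideal Y.
Proof. exact: rpredD. Qed.
Lemma hidealM Y F G : G \in hideal Y -> F * G \in hideal Y.
Proof. exact: idealMr. Qed.
Lemma hideal_primeM Y F G : F \notin hideal Y -> G \notin hideal Y -> F * G \notin hideal Y.
Proof. by move=> YF YG; apply/negP => /hideal_prime/orP[]; apply/negP. Qed.
Lemma hideal1 Y : 1 \notin hideal Y.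
Proof. by rewrite idealr1. Qed.
Lemma hidealX Y F n : F \notin hideal Y -> F ^+ n \notin hideal Y.
Proof.
move=> YF; elim: n => [|n IH]; first by rewrite expr0 hideal1.
by rewrite exprS hideal_primeM.
Qed.

Lemma projvar_eq Y Z : subvariety Y Z -> subvariety Z Y -> Y = Z.
Proof.
case: Y Z => [Y Y1 Y2 Y3 Y4] [Z Z1 Z2 Z3 Z4] YZ ZY.
have E : Y = Z :> (_ -> bool) by apply/funext => F; apply/idP/idP => [/ZY|/YZ].
by subst Z; f_equal; apply: Prop_irrelevance.
Qed.

(** All components of a separating polynomial lie in the ideal of [Y], and not all can lie in that
    of [Z]. *)
Lemma subvariety_form Y Z : subvariety Y Z -> Y <> Z ->
  exists d F, [/\ F \is d.-homog, F \in hideal Y & F \notin hideal Z].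
Proof.
move=> YZ neq; apply: contrapT => no; apply: neq; apply: projvar_eq => // F YF.
apply: (mem_homog_components (hideal0 Z)) => [|d]; first exact: hidealD.
apply: contrapT => /negP ZF; apply: no; exists d, (pihomog mdeg d F).
by split=> //; [exact: pihomogP | exact: hideal_homog].
Qed.

End Ideals.

(** * The local ring along a subvariety *)

Section LocalRing.
Variables (k : closedFieldType) (N : nat) (X : projvar k N).
Implicit Types (Y Z P : projvar k N) (F G : {mpoly k[N.+1]}).
Local Notation c := (Defs.coord X).

Lemma hcoordB F G : c (F - G) = c F - c G.
Proof. by rewrite /Defs.coord !rmorphB. Qed.
Lemma hcoordD F G : c (F + G) = c F + c G.
Proof. by rewrite /Defs.coord !rmorphD. Qed.
Lemma hcoordM F G : c (F * G) = c F * c G.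
Proof. by rewrite /Defs.coord !rmorphM. Qed.
Lemma hcoord1 : c 1 = 1.
Proof. by rewrite /Defs.coord !rmorph1. Qed.
Lemma hcoordX F n : c (F ^+ n) = c F ^+ n.
Proof. by rewrite /Defs.coord !rmorphXn. Qed.
Lemma hcoord_eq0 F : (c F == 0) = (F \in hideal X).
Proof.
rewrite /Defs.coord tofrac_eq0.
have := @Quotient.idealrBE _ (hideal X : idealr _) F 0.
by rewrite subr0 => ->; rewrite !rmorph0.
Qed.
Lemma hcoord0 : c 0 = 0.
Proof. by apply/eqP; rewrite hcoord_eq0 hideal0. Qed.
Lemma hcoord_neq0 Z G : subvariety Z X -> G \notin hideal Z -> c G != 0.
Proof. by move=> ZX; apply: contraNneq => /eqP; rewrite hcoord_eq0 => /ZX. Qed.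

Section At.
Variable Z : projvar k N.
Hypothesis ZX : subvariety Z X.
Local Notation A := (local_ring X Z).
Local Notation neq0 := (hcoord_neq0 ZX).

Lemma local_ring1 : A 1.
Proof.
exists 0%N, 1, 1; rewrite dhomog1 hideal1 hcoord1 divr1; split=> //; exact: dhomog1.
Qed.

Lemma local_ringB f g : A f -> A g -> A (f - g).
Proof.
move=> [d [F [G [hF hG ZG ->]]]] [e [F' [G' [hF' hG' ZG' ->]]]].
exists (d + e)%N, (F * G' - F' * G), (G * G'); split.
- by apply: rpredB; [|rewrite addnC]; exact: dhomogM.
- exact: dhomogM.
- exact: hideal_primeM.
- by rewrite hcoordB !hcoordM -mulNr addf_div ?mulNr ?neq0.
Qed.

Lemma local_ringM f g : A f -> A g -> A (f * g).
Proof.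
move=> [d [F [G [hF hG ZG ->]]]] [e [F' [G' [hF' hG' ZG' ->]]]].
exists (d + e)%N, (F * F'), (G * G'); split; rewrite ?dhomogM //.
- exact: hideal_primeM.
- by rewrite !hcoordM mulf_div.
Qed.

Lemma local_ideal_sub Y f : local_ideal X Z Y f -> A f.
Proof. by move=> [d [F [G [hF hG _ ZG ->]]]]; exists d, F, G. Qed.

Lemma local_ideal_ideal Y : is_ideal A (local_ideal X Z Y).
Proof.
split.
- exact: local_ideal_sub.
- exists 0%N, 0, 1; rewrite hideal0 hideal1 hcoord0 mul0r; split=> //; first exact: rpred0.
  exact: dhomog1.
- move=> f g [d [F [G [hF hG YF ZG ->]]]] [e [F' [G' [hF' hG' YF' ZG' ->]]]].
  exists (d + e)%N, (F * G' + F' * G), (G * G'); split.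
  + by apply: rpredD; [|rewrite addnC]; exact: dhomogM.
  + exact: dhomogM.
  + by rewrite hidealD // mulrC hidealM.
  + exact: hideal_primeM.
  + by rewrite hcoordD !hcoordM addf_div ?neq0.
- move=> f g [d [F [G [hF hG ZG ->]]]] [e [F' [G' [hF' hG' YF' ZG' ->]]]].
  exists (d + e)%N, (F * F'), (G * G'); split; rewrite ?dhomogM //.
  + exact: hidealM.
  + exact: hideal_primeM.
  + by rewrite !hcoordM mulf_div.
Qed.

(** Membership can be read off any numerator: cross-multiplication holds modulo the ideal of [X],
    and a denominator that is nonzero on [Z] is nonzero on [Y]. *)
Lemma local_idealE Y F G : subvariety Y X -> subvariety Z Y -> G \notin hideal Z ->
  local_ideal X Z Y (c F / c G) -> F \in hideal Y.
Proof.
move=> YX ZY ZG [d [F' [G' [hF' hG' YF' ZG' E]]]].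
have : F * G' - F' * G \in hideal X.
  rewrite -hcoord_eq0 hcoordB !hcoordM subr_eq0.
  by rewrite -eqr_div ?neq0 // E.
move=> /YX YE; have : F * G' \in hideal Y.
  by rewrite -(subrK (F' * G) (F * G')) hidealD // mulrC hidealM.
by move/hideal_prime/orP=> [//|/ZY]; rewrite (negPf ZG').
Qed.

Lemma local_ideal_prime Y : subvariety Y X -> subvariety Z Y ->
  prime_ideal A (local_ideal X Z Y).
Proof.
move=> YX ZY f g [d [F [G [hF hG ZG ->]]]] [e [F' [G' [hF' hG' ZG' ->]]]].
rewrite mulf_div -!hcoordM => /(local_idealE YX ZY (hideal_primeM ZG ZG')).
by move/hideal_prime/orP=> [YF|YF]; [left; exists d, F, G|right; exists e, F', G'].
Qed.

Lemma local_ring_inv f : A f -> ~ local_ideal X Z Z f -> A f^-1.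
Proof.
move=> [d [F [G [hF hG ZG ->]]]] nm; exists d, G, F; split=> //; last by rewrite invf_div.
by apply: contra_notN nm => ZF; exists d, F, G.
Qed.

Lemma local_ideal1 : ~ local_ideal X Z Z 1.
Proof.
rewrite -[1](divff (oner_neq0 (coord_frac X))) -hcoord1.
by move/(local_idealE ZX (fun _ => id) (hideal1 Z)); apply/negP/hideal1.
Qed.

Lemma local_ring_const (a : k) : A (c a%:MP).
Proof.
exists 0%N, a%:MP, 1; rewrite hideal1 hcoord1 divr1; split=> //; last exact: dhomog1.
by rewrite -[a%:MP]mulr1 mul_mpolyC rpredZ // dhomog1.
Qed.

End At.

End LocalRing.

Lemma dhomog_var (k : fieldType) (n : nat) (i : 'I_n) :
  ('X_i : {mpoly k[n]}) \is 1.-homog.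
Proof. by rewrite dhomogX; apply/eqP/mdeg1. Qed.

Lemma dhomog_varX (k : fieldType) (n : nat) (i : 'I_n) d :
  ('X_i ^+ d : {mpoly k[n]}) \is d.-homog.
Proof. by rewrite -{2}[d]mul1n; apply/dhomogMn/dhomog_var. Qed.

(** * Noetherianity of the local ring *)

Section Noether.
Variables (k : closedFieldType) (N : nat) (X Z : projvar k N) (j : 'I_N.+1).
Hypotheses (ZX : subvariety Z X) (Zj : 'X_j \notin hideal Z).
Implicit Types (F G : {mpoly k[N.+1]}).
Local Notation c := (Defs.coord X).
Local Notation A := (local_ring X Z).
Local Notation x := (c 'X_j).

Let x0 : x != 0. Proof. exact: (hcoord_neq0 ZX). Qed.

(* Dehomogenization: F |-> F(x_0/x_j, ..., x_N/x_j). *)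
Let delta := @mmap N.+1 k (coord_frac X)
  (@tofrac (coord_ring X) \o (\pi_(coord_ring X)%qT \o @mpolyC N.+1 k))
  (fun i => c 'X_i / x).

Let deltaM : {morph delta : F G / F * G}. Proof. exact: rmorphM. Qed.
Let deltaD : {morph delta : F G / F + G}. Proof. exact: rmorphD. Qed.

Let deltaE d F : F \is d.-homog -> delta F = c F / x ^+ d.
Proof.
move=> hF; rewrite /delta /mmap.
have -> : c F = \sum_(m <- msupp F) c (F@_m)%:MP * c 'X_[m].
  rewrite {1}[F]mpolyE /Defs.coord !raddf_sum /=; apply: eq_bigr => m _.
  by rewrite -mul_mpolyC !rmorphM.
rewrite mulr_suml big_seq [RHS]big_seq; apply: eq_bigr => m mF.
rewrite -mulrA; congr (_ * _); rewrite /mmap1 -(dhomog_mf hF mF).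
under eq_bigr do rewrite expr_div_n.
rewrite big_split /=; congr (_ * _).
  by rewrite mpolyXE_id /Defs.coord !rmorph_prod; apply: eq_bigr => i _; rewrite !rmorphXn.
rewrite prodfV mdegE; congr (_^-1).
by rewrite prodrXr.
Qed.

(** The preimage of [I] under [delta] is an ideal of the polynomial ring, hence finitely generated.
    A quotient of forms F / G is x^d / G times delta F, so the images of the generators generate
    [I]. *)
Lemma local_ring_noetherian (I : coord_frac X -> Prop) :
  is_ideal A I -> fin_gen A I.
Proof.
move=> [IA I0 ID IM].
have AX d F G : F \is d.-homog -> G \is d.-homog -> G \notin hideal Z -> A (c F / c G).
  by move=> hF hG ZG; exists d, F, G.
have delta_A F : A (delta F).
  rewrite /delta /mmap; apply: (subring_sum (local_ring1 X Z) (local_ringB ZX)) => m _.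
  apply: local_ringM; first exact: local_ring_const.
  rewrite /mmap1; apply: big_ind; [exact: local_ring1|exact: local_ringM|move=> i _].
  apply: (subringX (local_ring1 X Z) (@local_ringM _ _ X Z)).
  by apply: (AX 1%N) => //; apply: dhomog_var.
have [|||r [g [Ig gen]]] := @hilbert_basis k N.+1 (fun F => I (delta F)).
- by rewrite /delta raddf0.
- by move=> F G IF IG; rewrite deltaD; apply: ID.
- by move=> F G IG; rewrite deltaM; apply: IM.
exists r, (delta \o g); split=> // f If; have [d [F [G [hF hG ZG fE]]]] := IA _ If.
have G0 := hcoord_neq0 ZX ZG.
have xd0 : x ^+ d != 0 by rewrite -hcoordX; apply: (hcoord_neq0 ZX); apply: hidealX.
have hx := @dhomog_varX k N.+1 j d.
have [a FE] : exists a : 'I_r -> {mpoly k[N.+1]}, F = \sum_i a i * g i.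
  apply: gen; rewrite (deltaE hF).
  have -> : c F / x ^+ d = c G / x ^+ d * (c F / c G).
    by rewrite [RHS]mulrC mulrA (divfK G0).
  rewrite -fE; apply: IM => //; rewrite -hcoordX; apply: (AX d) => //.
  exact: hidealX.
exists (fun i => x ^+ d / c G * delta (a i)); split.
  move=> i; apply: local_ringM => //; rewrite -hcoordX; exact: (AX d).
rewrite fE; transitivity (x ^+ d / c G * delta F).
  by rewrite (deltaE hF) [RHS]mulrC mulrA (divfK xd0).
rewrite FE /delta raddf_sum mulr_sumr; apply: eq_bigr => i _ /=.
by rewrite -/delta deltaM mulrA.
Qed.
End Noether.

(** * From primes of the local ring to subvarieties through P *)

Section Homogenize.
Variables (k : closedFieldType) (N : nat) (X P : projvar k N).
Hypothesis PX : subvariety P X.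
Implicit Types (F G H : {mpoly k[N.+1]}).
Local Notation c := (Defs.coord X).
Local Notation A := (local_ring X P).

(** The ideal [S] of Y collects the polynomials all of whose components, divided by powers of a
    coordinate that is nonzero at [P], lie in [Q]. *)
Lemma homogenize_prime (Q : coord_frac X -> Prop) :
  is_ideal A Q -> prime_ideal A Q -> ~ Q 1 ->
  exists Y : projvar k N, [/\ subvariety Y X, subvariety P Y &
    forall d F H, F \is d.-homog -> H \is d.-homog -> H \notin hideal P ->
      F \in hideal Y <-> Q (c F / c H)].
Proof.
move=> [QA Q0 QD QM] Qp Q1.
have [j Pj] := hideal_relevant P.
have xd0 d : c ('X_j ^+ d) != 0 by apply: (hcoord_neq0 PX); apply: hidealX.
pose q d F := c (pihomog mdeg d F) / c ('X_j ^+ d).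
have Aq d F : A (q d F).
  exists d, (pihomog mdeg d F), ('X_j ^+ d).
  split=> //; [exact: pihomogP|exact: dhomog_varX|exact: hidealX].
have qD d F G : q d (F + G) = q d F + q d G.
  by rewrite /q pihomogD hcoordD mulrDl.
have qM d F G : q d (F * G) = \sum_(i < d.+1) q i F * q (d - i)%N G.
  rewrite /q pihomogM /Defs.coord !raddf_sum mulr_suml; apply: eq_bigr => i _.
  rewrite -!/(Defs.coord X _) mulf_div -!hcoordM -exprD subnKC //.
  by rewrite -ltnS.
have qhom d F : F \is d.-homog -> forall e, q e F = if e == d then c F / c ('X_j ^+ d) else 0.
  move=> hF e; rewrite /q; have [->|ne] := eqVneq; first by rewrite pihomog_dE.
  by rewrite (@pihomog_ne0 _ _ _ d) 1?eq_sym // hcoord0 mul0r.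
have Qsum n (f : 'I_n -> coord_frac X) (p : pred 'I_n) :
    (forall i, p i -> Q (f i)) -> Q (\sum_(i | p i) f i).
  by apply: big_ind.
pose S : {pred {mpoly k[N.+1]}} := fun F => `[< forall d, Q (q d F) >].
have SP F : reflect (forall d, Q (q d F)) (F \in S) by exact: asboolP.
have Shom d F : F \is d.-homog -> F \in S <-> Q (c F / c ('X_j ^+ d)).
  move=> hF; split=> [/SP/(_ d)|QF]; first by rewrite (qhom d) // eqxx.
  by apply/SP => e; rewrite (qhom d) //; case: eqP.
have S0 : 0 \in S by apply/SP => d; rewrite /q pihomog0 hcoord0 mul0r.
have S1 : 1 \notin S.
  have h1 : (1 : {mpoly k[N.+1]}) \is 0.-homog by exact: dhomog1.
  apply/negP => /(Shom 0%N _ h1); rewrite expr0 hcoord1 divr1.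
  exact: Q1.
have Sideal : idealr_closed S.
  split=> // F G H /SP SG /SP SH; apply/SP => d.
  rewrite qD qM; apply: (QD) => //; apply: Qsum => i _.
  exact: QM.
have Sprime : prime_idealr_closed S.
  move=> F G /SP SFG; apply/negPn/negP => /norP[SF SG].
  have exq H : H \notin S -> exists d, `[< ~ Q (q d H) >].
    move=> SH; apply: contrapT => no; move/negP: SH; apply; apply/SP => d.
    by apply: contrapT => nQ; apply: no; exists d; apply/asboolP.
  (* With a and b the lowest degrees in which F and G leave [Q], the component of F G in degree a +
     b is the product of these two components modulo [Q]. *)
  case: (ex_minnP (exq _ SF)) => a /asboolP Fa amin.
  case: (ex_minnP (exq _ SG)) => b /asboolP Gb bmin.
  have Fi i : (i < a)%N -> Q (q i F).
    move=> ia; apply: contrapT => nQ; have := amin i.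
    by rewrite leqNgt ia => /(_ (introT (asboolP _) nQ)).
  have Gi i : (i < b)%N -> Q (q i G).
    move=> ib; apply: contrapT => nQ; have := bmin i.
    by rewrite leqNgt ib => /(_ (introT (asboolP _) nQ)).
  have := SFG (a + b)%N; rewrite qM.
  have ab : (a < (a + b).+1)%N by rewrite ltnS leq_addr.
  rewrite (bigD1 (Ordinal ab)) //= addKn => QS.
  have : Q (q a F * q b G).
    set T := \sum_(i | _) _ in QS; rewrite -(addrK T (_ * _)); apply: (QD) => //.
    rewrite -mulN1r; apply: (QM).
      by apply: (subringN (local_ring1 X P) (local_ringB PX)); exact: local_ring1.
    apply: Qsum => i ia.
    have [lt_ia|le_ai] := ltnP i a; first by rewrite mulrC; apply: (QM) => //; apply: Fi.
    apply: (QM) => //; apply: Gi.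
    have lt_ai : (a < i)%N.
      by rewrite ltn_neqAle le_ai andbT; apply: contraNneq ia => ai; apply/eqP/val_inj.
    have iab : (i <= a + b)%N by rewrite -ltnS.
    by rewrite ltn_subLR // ltn_add2r.
  by case/Qp.
have Shomog F d : F \in S -> pihomog mdeg d F \in S.
  move=> /SP SF; apply/SP => e; rewrite /q pihomog_pihomog.
  have [->|_] := eqVneq; first exact: SF.
  by rewrite hcoord0 mul0r.
have Srel : exists i : 'I_N.+1, 'X_i \notin S.
  exists j; apply/negP => /(Shom 1%N _ (dhomog_var _ j)); rewrite expr1 divff //.
  by rewrite -['X_j]expr1.
exists (ProjVar Sideal Sprime Shomog Srel).
have key d F H : F \is d.-homog -> H \is d.-homog -> H \notin hideal P ->
    F \in S <-> Q (c F / c H).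
  move=> hF hH PH; rewrite (Shom d F hF); have H0 := hcoord_neq0 PX PH.
  have AH : A (c ('X_j ^+ d) / c H).
    by exists d, ('X_j ^+ d), H; split=> //; exact: dhomog_varX.
  have AX : A (c H / c ('X_j ^+ d)).
    by exists d, H, ('X_j ^+ d); split=> //; [exact: dhomog_varX|exact: hidealX].
  split=> [/(QM _ _ AH)|/(QM _ _ AX)].
    by rewrite [_ / _ * _]mulrC mulrA (divfK (xd0 d)).
  by rewrite [_ / _ * _]mulrC mulrA (divfK H0).
split=> [F XF|F SF|] //.
- apply/SP => d; rewrite /q.
  have /eqP -> : c (pihomog mdeg d F) == 0 by rewrite hcoord_eq0 hideal_homog.
  by rewrite mul0r.
- apply: contrapT => /negP PF.
  have [d Pd] : exists d, pihomog mdeg d F \notin hideal P.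
    apply: contrapT => no; move/negP: PF; apply.
    apply: (mem_homog_components (hideal0 P)) => [|d]; first exact: hidealD.
    by apply: contrapT => /negP Pd; apply: no; exists d.
  (* A component H in [S] that is nonzero at [P] would put H / H = 1 in [Q]. *)
  have := key _ _ _ (pihomogP mdeg d F) (pihomogP mdeg d F) Pd.
  rewrite (divff (hcoord_neq0 PX Pd)) => -[/(_ (Shomog _ d SF))] //.
Qed.

End Homogenize.

(** * Avoiding finitely many ideals *)

Lemma closed_field_infinite (k : closedFieldType) (s : seq k) : exists t, t \notin s.
Proof.
pose q := \prod_(a <- s) ('X - a%:P).
have q0 : q != 0 by rewrite monic_neq0 // monic_prod_XsubC.
(* This polynomial takes the value 1 on [s]; the factor X keeps its degree positive when [s] is
   empty. *)
have sp : size (q * 'X + 1) != 1%N.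
  by rewrite size_polyDl size_mulX ?size_prod_XsubC ?size_poly1.
have [t /rootP pt] := closed_rootP _ sp; exists t; apply/negP => ts.
have /rootP qt : root q t by rewrite root_prod_XsubC.
by move: pt; rewrite hornerD hornerM qt mul0r add0r hornerC => /eqP; rewrite oner_eq0.
Qed.

(** Induction on [L], with [G] avoiding the earlier ideals and [z] the new one. On the line of
    elements G + t z each ideal contains at most one point, and [k] is infinite. *)
Lemma ideal_avoidance (k : closedFieldType) (K : fieldType) (A : K -> Prop)
    (iota : k -> K) (T : eqType) (I : T -> K -> Prop) (m : K -> Prop) (L : seq T) :
  (forall a, A (iota a)) ->
  (forall a b, a != b -> exists2 u, A u & u * (iota a - iota b) = 1) ->
  A (-1) -> is_ideal A m ->
  (forall i, i \in L -> is_ideal A (I i) /\ exists2 z, m z & ~ I i z) ->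
  exists2 G, m G & forall i, i \in L -> ~ I i G.
Proof.
move=> Ai Ainv AN1 [_ m0 mD mM]; elim: L => [|j L IH] LI; first by exists 0.
have [|G mG GL] := IH; first by move=> i iL; apply: LI; rewrite inE iL orbT.
have [[_ _ jD jM] [z mz jz]] := LI j (mem_head _ _).
(* Two bad parameters would put both [z] and [G] in the ideal; the value 0 stands in when there is
   none. *)
have /choice [bad badP] : forall i, exists b, i \in j :: L ->
    forall t, I i (G + iota t * z) -> t = b.
  move=> i; have [[b bP]|no] := pselect (exists b, I i (G + iota b * z)); last first.
    by exists 0 => _ t It; case: no; exists t.
  exists b => ijL t tP; apply/eqP; apply: contrapT => /negP/Ainv [u Au utb].
  have [[_ _ iD iM] _] := LI i ijL.
  have iz : I i z.
    have -> : z = u * ((G + iota t * z) + (-1) * (G + iota b * z)).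
      by rewrite mulN1r opprD addrACA subrr add0r -mulrBl mulrA utb mul1r.
    by apply: (iM) => //; apply: iD => //; apply: iM.
  have iG : I i G.
    rewrite -(addrK (iota t * z) G) -mulN1r; apply: (iD) => //.
    by apply: (iM) => //; apply: iM.
  by move: ijL; rewrite inE => /orP[/eqP ij|/GL//]; apply: jz; rewrite -ij.
have [t tb] := closed_field_infinite [seq bad i | i <- j :: L].
exists (G + iota t * z); first by apply: mD => //; apply: mM.
by move=> i ijL /(badP i ijL) tE; move/negP: tb; apply; rewrite tE map_f.
Qed.

(** * Curves through a point of a normal surface *)

Section Surface.
Variables (k : closedFieldType) (N : nat) (X : projvar k N).

Lemma curveP (C : curve X) : subvariety (val C) X /\ has_dim (val C) 1.
Proof. by have /asboolP := valP C. Qed.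

Lemma pointP (P : point X) : subvariety (val P) X /\ has_dim (val P) 0.
Proof. by have /asboolP := valP P. Qed.

Lemma subvariety_trans (Z Y W : projvar k N) :
  subvariety Z Y -> subvariety Y W -> subvariety Z W.
Proof. by move=> ZY YW F /YW/ZY. Qed.

(** A prime that contains [G] and is smaller than the maximal ideal at [P] defines a subvariety [Y]
    strictly between [P] and [X], hence a curve; [G] vanishes on [Y] but on no curve of [L] through
    [P]. *)
Lemma curve_through_point (C : curve X) (L : seq (curve X)) :
  has_dim X 2 -> normal_variety X ->
  exists (D : curve X) (P : point X),
    [/\ D \notin L, subvariety (val P) (val C) & subvariety (val P) (val D)].
Proof.
move=> [X2 X3] Xn; have [CX [[P [PC neqPC _]] C2]] := curveP C.
have P1 : ~ dim_ge P 1 by move=> P1; apply: C2; exists P.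
have PX := subvariety_trans PC CX.
have Ppt : `[< subvariety P X /\ has_dim P 0 >] by apply/asboolP.
pose pt : point X := exist _ P Ppt.
have [j Pj] := hideal_relevant P.
pose A := local_ring X P; pose m := local_ideal X P P.
have A1 : A 1 by exact: local_ring1.
have AB : forall f g, A f -> A g -> A (f - g) by exact: local_ringB.
have AM : forall f g, A f -> A g -> A (f * g) by exact: local_ringM.
have mid : is_ideal A m by exact: local_ideal_ideal.
have proper (Y : projvar k N) : subvariety Y X -> subvariety P Y -> P <> Y ->
    exists2 z, m z & ~ local_ideal X P Y z.
  move=> YX PY neq; have [d [F [hF PF YF]]] := subvariety_form PY neq.
  have Pd := hidealX d Pj.
  exists (Defs.coord X F / Defs.coord X ('X_j ^+ d)).
    by exists d, F, ('X_j ^+ d); split=> //; exact: dhomog_varX.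
  by move=> /(local_idealE PX YX PY Pd); apply/negP.
have curve_neq (E : curve X) : P <> val E.
  by move=> PE; have [_ [E1 _]] := curveP E; apply: P1; rewrite PE.
(* Curves that miss [P] differ from any curve through [P]. Adding [C] ensures that [G] is
   nonzero. *)
pose L' := C :: [seq E <- L | `[< subvariety P (val E) >]].
have L'P (E : curve X) : E \in L' -> subvariety P (val E).
  by rewrite inE mem_filter => /orP[/eqP->//|/andP[/asboolP]].
have [|||||G mG GL] := @ideal_avoidance k _ A (fun a => Defs.coord X a%:MP) _
    (fun E : curve X => local_ideal X P (val E)) m L'.
- by move=> a; exact: local_ring_const.
- move=> a b ab; exists (Defs.coord X (a - b)^-1%:MP); first exact: local_ring_const.
  rewrite -hcoordB -hcoordM -mpolyCB -mpolyCM mulVf ?subr_eq0 //.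
  exact: hcoord1.
- by apply: (subringN A1 AB).
- exact: mid.
- move=> E EL'; split; first exact: local_ideal_ideal.
  by apply: proper; [have [] := curveP E|exact: L'P|exact: curve_neq].
have CL' : C \in L' by rewrite mem_head.
have G0 : G != 0.
  by apply: contra_notN (GL C CL') => /eqP ->; have [_] := local_ideal_ideal PX (val C).
have [d [F [hF CF XF]]] : exists d F,
    [/\ F \is d.-homog, F \in hideal (val C) & F \notin hideal X].
  by apply: subvariety_form => // CXE; apply: C2; rewrite CXE.
have Pd := hidealX d Pj.
have Xd := hcoord_neq0 PX Pd.
pose y := Defs.coord X F / Defs.coord X ('X_j ^+ d).
have Jy : local_ideal X P (val C) y.
  by exists d, F, ('X_j ^+ d); split=> //; exact: dhomog_varX.
have y0 : y != 0.
  apply: mulf_neq0; last by rewrite invr_eq0.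
  by rewrite hcoord_eq0.
have normal a b (p : {poly coord_frac X}) : A a -> A b -> b != 0 -> p \is monic ->
    (forall i, A p`_i) -> root p (a / b) -> A (a / b).
  move=> [e [U [V [hU hV PV ->]]]] [e' [U' [V' [hU' hV' PV' ->]]]] b0 pm pA pr.
  apply: (Xn pt) pr => //; exists (e + e')%N, (U * V'), (V * U').
  have U'0 : Defs.coord X U' != 0 by apply: contraNneq b0 => ->; rewrite mul0r eqxx.
  split; [exact: dhomogM|exact: dhomogM| |].
  - apply: hideal_primeM; last by rewrite -hcoord_eq0.
    by apply: contra PV; apply: PX.
  - by rewrite invf_div mulf_div !hcoordM.
have [Q [Qid Qp QG [z mz Qz]]] := normal_height_one A1 AB AM mid (@local_ideal1 _ _ _ _ PX)
  (@local_ring_inv _ _ X P) (local_ring_noetherian PX Pj) normal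
  (local_ideal_ideal PX (val C)) (local_ideal_prime PX CX PC) Jy y0
  (proper _ CX PC (curve_neq C)) mG G0.
have [QA Q0 QD QM] := Qid.
have Q1 : ~ Q 1.
  by move=> Q1; apply: Qz; rewrite -(mulr1 z); apply: QM => //; case: mid => + _ _ _; apply.
have [Y [YX PY YQ]] := homogenize_prime PX Qid Qp Q1.
have [e [U [V [hU hV PU PV GE]]]] := mG.
have YU : U \in hideal Y by apply/(YQ _ _ _ hU hV PV); rewrite -GE.
have YneqX : Y <> X.
  move=> YE; move: G0; rewrite GE; have -> : Defs.coord X U = 0.
    by apply/eqP; rewrite hcoord_eq0 -YE.
  by rewrite mul0r eqxx.
have PneqY : P <> Y.
  move=> PE; have [e' [U' [V' [hU' hV' PU' PV' zE]]]] := mz.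
  by apply: Qz; rewrite zE; apply/(YQ _ _ _ hU' hV' PV'); rewrite -PE.
(* [P] lies strictly in [Y], and a chain of length 2 below [Y] would give one of length 3 below
   [X]. *)
have Y1 : has_dim Y 1.
  split; first by exists P; split=> //; apply/eqP.
  by move=> Y2; apply: X3; exists Y; split=> //; apply/eqP.
have Ycurve : `[< subvariety Y X /\ has_dim Y 1 >] by apply/asboolP.
exists (exist _ Y Ycurve), pt; split=> //.
apply/negP => YL; apply: (GL (exist _ Y Ycurve)).
  by rewrite inE mem_filter YL andbT orbC; apply/orP; left; apply/asboolP.
by rewrite GE; exists e, U, V.
Qed.

End Surface.

(** * Positivity of intersection numbers *)

Section Intersection.
Variables (k : closedFieldType) (N : nat) (X : projvar k N).

Lemma mult_prime_div (D : curve X) m : mult D (prime_div D *+ m) = m.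
Proof. by rewrite /mult /prime_div raddfMn /= coeffU eqxx mulr1 natz. Qed.

(** If the quotient were 0, then 1 = a + f b with [a] in the ideal of [C], so f b = 1 - a would be a
    unit at [P] and hence along [D]. But f = u t^m vanishes along [D], as m > 0. *)
Lemma local_intersection_gt0 (P : point X) (C D : curve X) f d m : (0 < m)%N ->
  local_equation P (prime_div D *+ m) f ->
  subvariety (val P) (val C) -> subvariety (val P) (val D) ->
  local_intersection P C f d -> (0 < d)%N.
Proof.
move=> m0 [_ f0 /(_ D) eqD] PC PD; case: d => [|//] [w _ wP]; exfalso.
have [[[PX _] [CX _]] [DX _]] := (pointP P, curveP C, curveP D).
have [t [u [tP [v Lv [Lu uv]] fE]]] := eqD PD.
rewrite mult_prime_div in fE.
have [w0 [[a [b [Ia Lb ab1]]] _]] := wP 1 (local_ring1 _ _).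
rewrite big_ord0 subr0 in ab1.
have Pa : ~ local_ideal X (val P) (val P) (1 - a).
  have [_ _ mD _] := local_ideal_ideal PX (val P).
  move=> Pa; apply: (local_ideal1 PX); rewrite -(subrK a 1); apply: mD => //.
  by have [e [F [G [hF hG /PC PF PG ->]]]] := Ia; exists e, F, G.
have L1a : local_ring X (val P) (1 - a)^-1.
  apply: local_ring_inv => //; apply: (local_ringB PX); first exact: local_ring1.
  exact: local_ideal_sub Ia.
have sub g : local_ring X (val P) g -> local_ring X (val D) g.
  move=> [e [F [G [hF hG PG ->]]]]; exists e, F, G; split=> //.
  by apply: contra PG; apply: PD.
have fb : f * b = 1 - a by rewrite {1}ab1 addrAC subrr add0r.
have a10 : 1 - a != 0.
  apply: contra_notN Pa => /eqP ->.
  by have [] := local_ideal_ideal PX (val P).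
have tD : local_ideal X (val D) (val D) t.
  by apply/tP; exists 1; rewrite ?mulr1 //; exact: local_ring1.
apply: (@local_ideal1 _ _ X (val D) DX).
have -> : 1 = (u * t ^+ m.-1 * (b * (1 - a)^-1)) * t.
  rewrite mulrAC -[u * _ * t]mulrA -exprSr prednK // mulrA.
  by rewrite -[u * t ^+ m]fE fb divff.
have [_ _ _ DM] := local_ideal_ideal DX (val D).
apply: DM => //; apply: local_ringM; last by apply: local_ringM; exact: sub.
apply: local_ringM => //; apply: subringX; [exact: local_ring1|exact: local_ringM|].
exact: local_ideal_sub tD.
Qed.

Lemma cartier_intersection_gt0 (P : point X) (C D : curve X) m q : (0 < m)%N ->
  subvariety (val P) (val C) -> subvariety (val P) (val D) ->
  cartier_intersection (prime_div D *+ m) C q -> (0 < q)%N.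
Proof.
move=> m0 PC PD [_ _ [f [d [s [eqf intf us ds ->]]]]].
have dP := local_intersection_gt0 m0 (eqf P) PC PD (intf P).
have Ps : P \in s by apply: contraLR dP => /ds ->.
by rewrite (big_rem P) //= addn_gt0 dP.
Qed.
End Intersection.

Lemma cycle_enum_ord n (T : Type) (r : rel T) (f : 'I_n -> T) :
  (forall i, r (f i) (f (ordS i))) -> cycle r [seq f i | i <- enum 'I_n].
Proof.
(* The cycle is compared with the natural numbers up to n under successor modulo n + 1. *)
case: n f => [|n] f rf; first by rewrite (size0nil (size_enum_ord 0)).
pose e (i j : nat) := j == (i.+1 %% n.+1)%N.
have er : subrel (relpre val e) (relpre f r).
  move=> i j /= /eqP ij; have -> : j = ordS i by apply: val_inj.
  exact: rf.
rewrite cycle_map (sub_cycle er) // -cycle_map val_enum_ord /=.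
suff E m : forall a, (a + m)%N = n -> path e a (rcons (iota a.+1 m) 0%N).
  exact: E.
elim: m => [|m IH] a; first by rewrite addn0 => -> /=; rewrite /e modnn.
move=> an /=; rewrite IH ?addSnnS // andbT /e modn_small //.
by rewrite ltnS -an addnS ltnS leq_addr.
Qed.

(** * The real class space and the Picard rank *)

Section ScalarExtension.
Variables (k : closedFieldType) (N : nat) (X : projvar k N).
Variables (R : realType) (V : vectType R) (iota : {additive Cl X -> V}).
Hypothesis iota_ext : is_scalar_extension iota.

(** The identity and the projection onto [W] both extend [iota], so they agree by uniqueness. *)
Lemma scalar_extension_span (W : {vspace V}) : (forall x, iota x \in W) -> W = fullv.
Proof.
move=> iW; have [h _ huniq] := iota_ext iota.
have id_h : (idfun : V -> V) =1 h by apply: (huniq idfun).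
have proj_h : projv W =1 h by apply: (huniq (projv W)) => x; apply: projv_id.
apply/eqP; rewrite eqEsubv subvf; apply/subvP => v _.
by have -> : v = projv W v; [rewrite proj_h -id_h | exact: memv_proj].
Qed.

Lemma scalar_extension_free r : (r <= \dim (@fullv _ V))%N ->
  exists s : r.-tuple (Cl X), free [tuple of [seq iota x | x <- s]].
Proof.
elim: r => [|r IH] rV; first by exists [tuple]; exact: nil_free.
have [s sfree] := IH (ltnW rV).
have [x xs] : exists x, iota x \notin <<[seq iota x | x <- s]>>%VS.
  apply: contrapT => no; have E := @scalar_extension_span <<[seq iota x | x <- s]>>%VS.
  move: rV; rewrite -E ?(eqP sfree) ?size_tuple ?ltnn // => x.
  by apply/negPn/negP => xs; apply: no; exists x.
by exists [tuple of x :: s]; rewrite /= free_cons xs.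
Qed.

(** Q-factoriality moves positive multiples of classes with free images into [Pic]. An integral
    relation among these multiples is a real relation among the images, hence trivial; so there are
    at most r of them. *)
Lemma dim_le_picard_rank r : Qfactorial X -> picard_rank X r ->
  (\dim (@fullv _ V) <= r)%N.
Proof.
move=> Xq [_ rmax]; rewrite leqNgt; apply/negP => /scalar_extension_free [s /freeP sfree].
have /choice [m mP] : forall x : Cl X, exists m, (0 < m)%N /\ Pic (x *+ m).
  move=> x; have [m m0 mc] := Xq (repr x); exists m; split=> //.
  exists (repr x *+ m) => //.
  by rewrite /divclass raddfMn /= reprK.
apply: (rmax (fun i => tnth s i *+ m (tnth s i))) => [i|c cs i].
  by have [] := mP (tnth s i).
have : (c i)%:~R * (m (tnth s i))%:R = 0 :> R.
  apply: (sfree (fun i => (c i)%:~R * (m (tnth s i))%:R)).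
  have /(congr1 iota) := cs; rewrite raddf0 raddf_sum => cs0; rewrite -[RHS]cs0.
  apply: eq_bigr => j _; rewrite raddfMz raddfMn -scaler_int -scaler_nat scalerA.
  by rewrite (nth_map 0) ?size_tuple // -tnth_nth.
have [m0 _] := mP (tnth s i).
move/eqP; rewrite mulf_eq0 pnatr_eq0 [_ == 0%N]gtn_eqF // orbF intr_eq0.
by move/eqP.
Qed.

End ScalarExtension.

(** * The intersection form on classes of curves *)

Section IntersectionForm.
Variables (k : closedFieldType) (N : nat) (X : projvar k N).
Variables (R : realType) (V : vectType R) (iota : {additive Cl X -> V}).
Variables (B : V -> V -> R).
Hypotheses (X_Qfact : Qfactorial X) (B_int : is_intersection_form iota B).
Local Notation cls := (curve_class iota).

Lemma curve_form_ge0 (C D : curve X) : C != D -> 0 <= B (cls C) (cls D).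
Proof.
have [_ _ BE] := B_int; have [m m0 mC] := X_Qfact (prime_div C) => CD.
by have [q _ ->] := BE C D m CD m0 mC; rewrite divr_ge0.
Qed.

Lemma curve_form_gt0 (C D : curve X) (P : point X) : C != D ->
  subvariety (val P) (val C) -> subvariety (val P) (val D) ->
  0 < B (cls C) (cls D).
Proof.
have [_ _ BE] := B_int; have [m m0 mC] := X_Qfact (prime_div C) => CD PC PD.
have [q qE ->] := BE C D m CD m0 mC.
by rewrite divr_gt0 ?ltr0n // (cartier_intersection_gt0 m0 PD PC qE).
Qed.

(* Stands in for an ample class: it is positive on finitely many given curves. *)
Lemma positive_class (L : seq (curve X)) : has_dim X 2 -> normal_variety X ->
  exists h, forall C, C \in L -> 0 < B h (cls C).
Proof.
move=> X2 Xn; have [BC Bl _] := B_int.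
have /choice [D DP] : forall C : curve X, exists D : curve X, D \notin L /\
    exists P : point X, subvariety (val P) (val C) /\ subvariety (val P) (val D).
  by move=> C; have [D [P [DL PC PD]]] := curve_through_point C L X2 Xn; exists D; split;
    last exists P.
exists (\sum_(C <- L) cls (D C)) => C CL; rewrite BC scalar_sum // (big_rem C) //=.
(* The curve [D C] meets [C]; the other summands are nonnegative because no [D E] belongs to [L]. *)
have neq E : C != D E by apply: contraTneq CL => ->; case: (DP E).
apply: ltr_wpDr; first by apply: sumr_ge0 => E _; apply: curve_form_ge0.
by have [_ [P [PC PD]]] := DP C; apply: curve_form_gt0 PC PD.
Qed.

Lemma Eff_curve_cone (K : V -> Prop) v :
  (forall C, cone K (cls C)) -> Eff iota v -> cone K v.
Proof.
move=> KC; apply: cone_trans => _ [E Eeff ->].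
rewrite -(freeg_sumE E) /divclass !raddf_sum /=.
apply: (big_ind (cone K)); [exact: cone0|exact: coneD|move=> C _].
have -> : << coeff C E *g C >> = prime_div C *+ absz (mult C E).
  apply/eqP/freeg_eqP => C'; rewrite coeffMn !coeffU mul1r.
  by rewrite -[RHS]mulr_natl [X in _ = X * _]natz gez0_abs.
rewrite !raddfMn -scaler_nat; apply: coneZ; [exact: ler0n|exact: KC].
Qed.

Lemma curve_class_Eff (C : curve X) : Eff iota (cls C).
Proof.
apply: cone_mem; exists (prime_div C) => // C'.
by rewrite /mult coeffU mul1r ler0n.
Qed.

End IntersectionForm.

(** * The effective cone *)

Theorem proposition1p1 (k : closedFieldType) (N : nat) (X : projvar k N)
  (X_surface : has_dim X 2) (X_normal : normal_variety X) (X_Qfact : Qfactorial X)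
  (Cl_fg : finitely_generated (Cl X)) (X_rank3 : picard_rank X 3)
  (R : realType) (V : vectType R) (iota : {additive Cl X -> V})
  (iota_ext : is_scalar_extension iota)
  (B : V -> V -> R) (B_int : is_intersection_form iota B)
  (n : nat) (D : 'I_n -> curve X) (D_inj : injective D)
  (S : seq V := [seq curve_class iota (D i) | i <- enum 'I_n])
  (S_dim : cone_dim S = 3%N)
  (S_nsd : forall i : 'I_n,
     neg_semidefinite
       (gram2 B (curve_class iota (D i)) (curve_class iota (D (ordS i))))) :
  forall v : V, Eff iota v <-> cone_of S v.
Proof.
have [BC Bl _] := B_int.
(* The Picard rank bounds the dimension above, the span of [S] bounds it below. *)
have dimV : \dim (@fullv _ V) = 3%N.
  apply/eqP; rewrite eqn_leq (dim_le_picard_rank iota_ext X_Qfact X_rank3).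
  by rewrite -S_dim dimvS // subvf.
have SV : <<S>>%VS = fullv.
  by apply/eqP; rewrite eqEdim subvf dimV -S_dim /=.
have S_cycle : cycle (nsd B) S by apply: cycle_enum_ord => i; apply: gram2_nsd.
(* Only distinct positions are compared, hence distinct curves; self-intersections do not occur. *)
have S_pair : pairwise (fun u v => 0 <= B u v) S.
  rewrite pairwise_map; have := enum_uniq 'I_n; rewrite uniq_pairwise.
  apply: sub_pairwise => i j /= ij; apply: (curve_form_ge0 X_Qfact B_int).
  by rewrite (inj_eq D_inj).
have memS i : curve_class iota (D i) \in S by apply: map_f; rewrite mem_enum.
move=> v; split; last first.
  apply: cone_trans => _ /mapP [i _ ->]; exact: curve_class_Eff.
apply: Eff_curve_cone => C.
(* A curve of the tuple is a generator; any other curve is nonnegative on [S], so [nef_in_cone]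
   applies. *)
have [[i ->]|CD] := pselect (exists i, C = D i); first exact: cone_mem.
have [h hP] := positive_class X_Qfact B_int (C :: [seq D i | i <- enum 'I_n])
  X_surface X_normal.
apply: (nef_in_cone dimV BC Bl (h := h) SV S_cycle S_pair).
- by move=> _ /mapP [i _ ->]; apply: hP; rewrite inE map_f ?orbT ?mem_enum.
- move=> _ /mapP [i _ ->]; apply: (curve_form_ge0 X_Qfact B_int).
  by apply: contra_notN CD => /eqP; exists i.
- by apply: hP; rewrite mem_head.
Qed.
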